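(* Let $r=(\mathrm{Ad}_X\otimes\mathrm{Ad}_X)(r_{BD})$ for some Belavin--Drinfeld $r$-matrix $r_{BD}=r_0+r_1$ over $K$ and some $X\in\mathrm{GL}(n,K)$. Then $\partial r$ defines a Lie bialgebra structure on $\mathfrak g=\mathfrak{su}(n,F,d)$ if and only if $X^*X=SD$ for some $D\in C(r_{BD})$, $\overline{r_0}=(\mathrm{Ad}_S\otimes\mathrm{Ad}_S)(r_0)$, and the admissible triple $(\Gamma_1,\Gamma_2,\tau)$ associated to $r_{BD}$ satisfies $s(\Gamma_i)=\Gamma_i$ for $i\in\{1,2\}$ and $s\tau=\tau s$.
   Context: $F$ is a field of characteristic zero, $d\in F^*\setminus {F^*}^2$, $K=F(\sqrt d)$, $\overline F$ an algebraic closure of $F$ containing $K$, $n$ a positive integer. The bar denotes the nontrivial element of $\mathrm{Gal}(K/F)$, applied entrywise to matrices and extended to tensors; $A^*=\overline A^T$. $\mathfrak{su}(n,F,d)=\{A\in\mathfrak{sl}(n,K):A^*+A=0\}$, an $F$-Lie algebra with scalar extension $\mathfrak{sl}(n,K)$ to $K$. $\mathrm{Ad}_X(A)=XAX^{-1}$; $\partial r$ is the map $a\mapsto[r,a\otimes1+1\otimes a]$, and it defines a Lie bialgebra structure on $\mathfrak g$ if $[r,a\otimes1+1\otimes a]\in\mathfrak g\otimes_F\mathfrak g$ for all $a\in\mathfrak g$. For $r=\sum a_i\otimes b_i$, $r^{21}=\sum b_i\otimes a_i$. $S\in\mathrm{GL}(n,F)$ is the anti-diagonal matrix $S_{ij}=\delta_{i,n+1-j}$,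 and $s:\Gamma\to\Gamma$ is the map $s(\alpha_i)=\alpha_{n-i}$ on the simple roots. $C(r_{BD})$ is the set of $M\in\mathrm{GL}(n,\overline F)$ with $(\mathrm{Ad}_M\otimes\mathrm{Ad}_M)(r_{BD})=r_{BD}$. Belavin--Drinfeld $r$-matrices for $\mathfrak{sl}(n)$: let $\mathfrak h$ be the diagonal Cartan subalgebra, $\Delta^+$ the positive roots with upper triangular root vectors, $\Gamma=\{\alpha_1,\dots,\alpha_{n-1}\}$ the simple roots ($\alpha_i$ has root vector $E_{i,i+1}$), $e_\alpha$ the root vectors given by the matrix units $E_{ij}$ ($i\ne j$), $\Omega$ the Casimir element with respect to the trace form, and $\Omega_0$ its component in $\mathfrak h\otimes\mathfrak h$. An admissible triple $(\Gamma_1,\Gamma_2,\tau)$ consists of $\Gamma_1,\Gamma_2\subseteq\Gamma$ and an isometric bijection $\tau:\Gamma_1\to\Gamma_2$ such that for each $\alpha\in\Gamma_1$ some $\tau^k(\alpha)\notin\Gamma_1$. A Belavin--Drinfeld $r$-matrix associated to it is $r_{BD}=r_0+r_1$ with $r_0\in\mathfrak h\otimes\mathfrak h$, $r_0+r_0^{21}=\Omega_0$, $(\tau(\alpha)\otimes\mathrm{Id}+\mathrm{Id}\otimes\alpha)(r_0)=0$ for all $\alpha\in\Gamma_1$, and $r_1=\sum_{\alpha\in\Delta^+}e_\alpha\otimes e_{-\alpha}+\sum_{\alpha\in\mathrm{Span}(\Gamma_1)^+}\sum_{k\ge1}e_\alpha\wedge e_{-\tau^k(\alpha)}$, where $a\wedge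 b=a\otimes b-b\otimes a$, $\mathrm{Span}(\Gamma_1)^+$ is the set of positive roots in the span of $\Gamma_1$, the sum is over those $k$ for which $\tau^k(\alpha)$ is defined, and $e_{-\tau^k(\alpha)}$ means $\theta^k(e_{-\alpha})$, $\theta$ being the Lie algebra isomorphism (between the subalgebras generated by the $e_{\pm\alpha}$ with $\alpha\in\Gamma_1$, resp. $\Gamma_2$) with $e_{\pm\alpha}\mapsto e_{\pm\tau(\alpha)}$ for $\alpha\in\Gamma_1$. ''Over $K$'' means $r_0\in\mathfrak h_K\otimes_K\mathfrak h_K$ with $\mathfrak h_K$ the diagonal matrices in $\mathfrak{sl}(n,K)$. *)

(* Defs.v *)
From HB Require Import structures.
From mathcomp Require Import all_boot all_order all_fingroup all_algebra.
From mathcomp Require Import all_field.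
From mathcomp Require Export mxtens.

Set Implicit Arguments.
Unset Strict Implicit.
Unset Printing Implicit Defensive.

Import GRing.Theory.
Local Open Scope ring_scope.

(* The tensor square of M_n(K) over K is modelled by 'M[K]_(n * n), a (x) b    *)
(* being the Kronecker product a *t b; this is an isomorphism of algebras.    *)
Section Tensors.

Variables (K : fieldType) (n : nat).
Implicit Types (a b : 'M[K]_n) (t : 'M[K]_(n * n)).

(* The linear map on M_n (x) M_n induced by a bilinear map f, see             *)
(* [tens_liftE]; the scalar below is the coordinate of t on E_ij (x) E_kl.    *)
Definition tens_lift (V : lmodType K) (f : 'M[K]_n -> 'M[K]_n -> V) t : V :=
  \sum_(i < n) \sum_(j < n) \sum_(k < n) \sum_(l < n)
    t (mxtens_index (i, k)) (mxtens_index (j, l)) *: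
      f (delta_mx i j) (delta_mx k l).

Lemma tens_liftE (V : lmodType K) (f : 'M[K]_n -> 'M[K]_n -> V) a b :
    (forall y, linear (fun x => f x y)) -> (forall x, linear (f x)) ->
  tens_lift f (a *t b) = f a b.
Proof.
move=> fl fr.
have fsuml y I (r : seq I) (P : pred I) (c : I -> K) (x : I -> 'M[K]_n) :
  f (\sum_(i <- r | P i) c i *: x i) y = \sum_(i <- r | P i) c i *: f (x i) y.
  pose g := GRing.isLinear.Build _ _ _ _ (fun x => f x y) (fl y).
  pose h : {linear 'M[K]_n -> V} := HB.pack (fun x => f x y) g.
  rewrite -[LHS]/(h _) linear_sum; apply: eq_bigr => i _.
  by rewrite linearZ.
have fsumr x I (r : seq I) (P : pred I) (c : I -> K) (y : I -> 'M[K]_n) :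
  f x (\sum_(i <- r | P i) c i *: y i) = \sum_(i <- r | P i) c i *: f x (y i).
  pose g := GRing.isLinear.Build _ _ _ _ (f x) (fr x).
  pose h : {linear 'M[K]_n -> V} := HB.pack (f x) g.
  rewrite -[LHS]/(h _) linear_sum; apply: eq_bigr => i _.
  by rewrite linearZ.
have mxE' (c : 'M[K]_n) : c = \sum_(p : 'I_n * 'I_n) c p.1 p.2 *: delta_mx p.1 p.2.
  by rewrite [LHS]matrix_sum_delta pair_bigA.
rewrite [in RHS](mxE' a) fsuml /tens_lift pair_bigA; apply: eq_bigr => -[i j] _.
rewrite /= [in RHS](mxE' b) fsumr pair_bigA scaler_sumr.
by apply: eq_bigr => -[k l] _; rewrite /= tensmxE scalerA.
Qed.

Definition tens_map (f g : 'M[K]_n -> 'M[K]_n) : 'M[K]_(n * n) -> 'M[K]_(n * n) :=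
  tens_lift (fun a b => f a *t g b).

Definition tens_flip : 'M[K]_(n * n) -> 'M[K]_(n * n) :=
  tens_lift (fun a b => b *t a).

Definition tens_wedge a b : 'M[K]_(n * n) := a *t b - b *t a.

(* V (x) V inside M_n(K) (x)_K M_n(K), as the additive span of the a (x) b.   *)
(* For a K-subspace V this is V (x)_K V; for an F-form V of a K-subspace      *)
(* (such as su(n, F, d) in sl(n, K)) it is the image of V (x)_F V under the   *)
(* canonical map, which is then injective.                                    *)
Definition tens_sub (V : 'M[K]_n -> Prop) t : Prop :=
  exists s : seq ('M[K]_n * 'M[K]_n),
    (forall p, p \in s -> V p.1 /\ V p.2) /\ t = \sum_(p <- s) p.1 *t p.2.

Definition Ad (X a : 'M[K]_n) : 'M[K]_n := X *m a *m invmx X.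

Definition Ad2 (X : 'M[K]_n) : 'M[K]_(n * n) -> 'M[K]_(n * n) :=
  tens_map (Ad X) (Ad X).

(* The coboundary a |-> [r, a (x) 1 + 1 (x) a].                               *)
Definition coboundary (r : 'M[K]_(n * n)) a : 'M[K]_(n * n) :=
  let da := a *t (1%:M : 'M[K]_n) + (1%:M : 'M[K]_n) *t a in
  r *m da - da *m r.

Definition defines_Lie_bialgebra (g : 'M[K]_n -> Prop) (r : 'M[K]_(n * n)) :=
  forall a, g a -> tens_sub g (coboundary r a).

Definition cartan a : Prop := is_diag_mx a /\ \tr a = 0.

(* The Casimir element of sl(n) for the trace form, see [casimirE].           *)
Definition casimir : 'M[K]_(n * n) :=
  \sum_(i < n) \sum_(j < n) delta_mx i j *t delta_mx j i
  - n%:R^-1 *: ((1%:M : 'M[K]_n) *t (1%:M : 'M[K]_n)).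

Lemma casimirE m (x y : 'I_m -> 'M[K]_n) :
    (forall a, \tr a = 0 -> exists c : 'I_m -> K, a = \sum_k c k *: x k) ->
    (forall k, \tr (y k) = 0) ->
    (forall k l, \tr (x k *m y l) = (k == l)%:R) ->
    n%:R != 0 :> K ->
  casimir = \sum_k x k *t y k.
Proof.
move=> xsp yt dual n0.
have xE a : \tr a = 0 -> a = \sum_k \tr (a *m y k) *: x k.
  move=> /xsp [c ac]; rewrite {1}ac; apply: eq_bigr => k _; congr (_ *: _).
  rewrite ac mulmx_suml raddf_sum (bigD1 k) //= -scalemxAl linearZ /= dual eqxx.
  rewrite mulr1 big1 ?addr0 // => l lk.
  by rewrite -scalemxAl linearZ /= dual (negPf lk) mulr0.
apply/matrixP => p q; case: (mxtens_indexP p) (mxtens_indexP q) => i k [j l].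
pose e : 'M[K]_n := delta_mx l k.
have tre : \tr e = (l == k)%:R.
  rewrite /mxtrace (bigD1 l) //= mxE eqxx big1 ?addr0 // => u ul.
  by rewrite mxE (negPf ul).
have trey m' : \tr ((e - (\tr e / n%:R)%:M) *m y m') = y m' k l.
  rewrite mulmxBl mul_scalar_mx linearB linearZ /= yt mulr0 subr0.
  rewrite mxtrace_mulC /mxtrace (bigD1 k) //= big1 => [|u uk].
    rewrite addr0 mxE (bigD1 l) //= big1 => [|u ul].
      by rewrite !mxE !eqxx mulr1 addr0.
    by rewrite mxE (negPf ul) mulr0.
  by rewrite mxE big1 // => v _; rewrite mxE (negPf uk) andbF mulr0.
have /xE/matrixP/(_ i j) : \tr (e - (\tr e / n%:R)%:M) = 0.
  by rewrite linearB /= mxtrace_scalar -[X in _ - X]mulr_natr divfK ?subrr.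
rewrite !summxE => E; transitivity ((e - (\tr e / n%:R)%:M) i j).
  rewrite tre /casimir [LHS]mxE [X in _ + X]mxE.
  have -> : (\sum_(u < n) \sum_(v < n) (delta_mx u v : 'M[K]_n) *t delta_mx v u)
      (mxtens_index (i, k)) (mxtens_index (j, l)) = ((k == j) && (l == i))%:R.
    rewrite summxE (bigD1 i) //= summxE (bigD1 j) //=.
    rewrite tensmxE !mxE !eqxx mul1r [X in _ + X]big1 ?addr0 => [|u ui].
      rewrite [X in _ + X]big1 ?addr0 // => v vj.
      by rewrite tensmxE mxE [j == v]eq_sym (negPf vj) andbF mul0r.
    rewrite summxE big1 // => v _.
    by rewrite tensmxE mxE [i == u]eq_sym (negPf ui) mul0r.
  rewrite [X in _ - X]mxE tensmxE !mxE.
  rewrite [l == k]eq_sym [k == j]eq_sym [l == i]eq_sym andbC.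
  congr (_ - _); case: (k == l); case: (i == j);
    by rewrite ?mulr1n ?mulr0n ?mulr1 ?mul1r ?mulr0 ?mul0r.
rewrite E; apply: eq_bigr => u _; by rewrite trey tensmxE mxE mulrC.
Qed.

(* The component in h (x) h: the projection of sl(n) onto h along the root    *)
(* spaces keeps the diagonal part.                                            *)
Definition diag_part a : 'M[K]_n := diag_mx (\row_i a i i).

Definition casimir0 : 'M[K]_(n * n) := tens_map diag_part diag_part casimir.

End Tensors.

Section Roots.

Variables (K : fieldType) (n : nat).
Implicit Types (v w : 'rV[K]_n) (a b : 'M[K]_n).

Lemma ord_succ_proof (i : 'I_n.-1) : (i.+1 < n)%N.
Proof. by rewrite -ltn_predRL. Qed.

Definition ord_lo (i : 'I_n.-1) : 'I_n := widen_ord (leq_pred n) i.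
Definition ord_hi (i : 'I_n.-1) : 'I_n := Ordinal (ord_succ_proof i).

(* A linear form on h is represented by the row vector v with sum of entries  *)
(* 0 such that the form is H |-> \sum_k v_k H_kk (this is one-to-one and onto *)
(* in characteristic 0); the form on h^* dual to the trace form is then the   *)
(* standard dot product. The simple root alpha_(i+1) has index i : 'I_n.-1,   *)
(* and the root with root vector E_ij is e_i - e_j.                           *)
Definition root_eval v a : K := \sum_k v 0 k * a k k.
Definition root_dot v w : K := \sum_k v 0 k * w 0 k.
Definition root_vec (i j : 'I_n) : 'rV[K]_n := delta_mx 0 i - delta_mx 0 j.
Definition simple_root (i : 'I_n.-1) : 'rV[K]_n := root_vec (ord_lo i) (ord_hi i).
Definition simple_roots : n.-1.-tuple 'rV[K]_n := [tuple simple_root i | i < n.-1].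

Definition e_pos (i : 'I_n.-1) : 'M[K]_n := delta_mx (ord_lo i) (ord_hi i).
Definition e_neg (i : 'I_n.-1) : 'M[K]_n := delta_mx (ord_hi i) (ord_lo i).

Definition lie_br a b : 'M[K]_n := a *m b - b *m a.

(* The Lie subalgebra generated by the e_(+-alpha), alpha in G.               *)
Inductive lie_gen (G : {set 'I_n.-1}) : 'M[K]_n -> Prop :=
| LieGenPos i : i \in G -> lie_gen G (e_pos i)
| LieGenNeg i : i \in G -> lie_gen G (e_neg i)
| LieGen0 : lie_gen G 0
| LieGenLin (c : K) a b : lie_gen G a -> lie_gen G b -> lie_gen G (c *: a + b)
| LieGenBr a b : lie_gen G a -> lie_gen G b -> lie_gen G (lie_br a b).

End Roots.

(* The values of BD_tau outside BD_G1 are irrelevant.                         *)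
Record BD_triple (n : nat) := BDTriple {
  BD_G1 : {set 'I_n.-1};
  BD_G2 : {set 'I_n.-1};
  BD_tau : 'I_n.-1 -> 'I_n.-1 }.

Section BelavinDrinfeld.

Variables (K : fieldType) (n : nat) (T : BD_triple n).
Local Notation G1 := (BD_G1 T).
Local Notation G2 := (BD_G2 T).
Local Notation tau := (BD_tau T).
Local Notation alpha := (@simple_root K n).

Definition admissible : Prop :=
  [/\ tau @: G1 = G2, {in G1 &, injective tau},
      {in G1 &, forall i j,
         root_dot (alpha (tau i)) (alpha (tau j)) = root_dot (alpha i) (alpha j)}
    & {in G1, forall i, exists k, iter k tau i \notin G1}].

Definition span_G1 : {vspace 'rV[K]_n} := <<[seq alpha i | i in G1]>>%VS.

(* The linear extension of tau to the span of G1.                             *)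
Definition tau_ext (v : 'rV[K]_n) : 'rV[K]_n :=
  \sum_(i in G1) coord (simple_roots K n) i v *: alpha (tau i).

(* tau^k(v) is defined.                                                       *)
Definition tau_defined (k : nat) (v : 'rV[K]_n) : bool :=
  [forall j : 'I_k, iter j tau_ext v \in span_G1].

(* theta restricts to the Lie algebra isomorphism from the subalgebra of G1   *)
(* to that of G2 with e_(+-alpha) |-> e_(+-tau(alpha)).                       *)
Definition is_theta (theta : 'M[K]_n -> 'M[K]_n) : Prop :=
  [/\ {in G1, forall i, theta (e_pos K i) = e_pos K (tau i)
                     /\ theta (e_neg K i) = e_neg K (tau i)},
      forall (c : K) a b, lie_gen G1 a -> lie_gen G1 b ->
        theta (c *: a + b) = c *: theta a + theta b,
      forall a b, lie_gen G1 a -> lie_gen G1 b ->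
        theta (lie_br a b) = lie_br (theta a) (theta b),
      forall a b, lie_gen G1 a -> lie_gen G1 b -> theta a = theta b -> a = b
    & forall b, lie_gen G2 b <-> exists2 a, lie_gen G1 a & b = theta a].

(* e_(-tau^k(alpha)) is theta^k(e_(-alpha)). The range k < n excludes no       *)
(* defined power of tau, see [tau_defined_ltn].                               *)
Definition BD_r1 (theta : 'M[K]_n -> 'M[K]_n) : 'M[K]_(n * n) :=
  \sum_(i < n) \sum_(j < n | (i < j)%N) delta_mx i j *t delta_mx j i
  + \sum_(i < n) \sum_(j < n | (i < j)%N && (root_vec K i j \in span_G1))
      \sum_(1 <= k < n | tau_defined k (root_vec K i j))
        tens_wedge (delta_mx i j) (iter k theta (delta_mx j i)).

Definition is_BD_rmatrix (r0 r1 : 'M[K]_(n * n)) : Prop :=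
  [/\ admissible,
      tens_sub (@cartan K n) r0,
      r0 + tens_flip r0 = casimir0 K n,
      {in G1, forall i,
         tens_lift (fun a b => root_eval (alpha (tau i)) a *: b
                               + root_eval (alpha i) b *: a) r0 = 0}
    & exists2 theta, is_theta theta & r1 = BD_r1 theta].

End BelavinDrinfeld.

Section Bound.

Variables (K : fieldType) (n : nat) (T : BD_triple n).
Local Notation G1 := (BD_G1 T).
Local Notation tau := (BD_tau T).
Local Notation B := (simple_roots K n).

Lemma simple_roots_nth (i : 'I_n.-1) : B`_i = simple_root K i.
Proof. by rewrite -tnth_nth tnth_mktuple. Qed.

Lemma free_simple_roots : free B.
Proof.
apply/freeP => c c0; suff H m : forall i : 'I_n.-1, (i < m)%N -> c i = 0.
  by move=> i; apply: (H i.+1).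
elim: m => // m IHm i lim; have := congr1 (fun v : 'rV_n => v 0 (ord_lo i)) c0.
rewrite mxE summxE (bigD1 i) //= big1 => [|j ji].
  rewrite simple_roots_nth !mxE !eqxx /= -val_eqE /= ltn_eqF // subr0 addr0.
  by rewrite mulr1.
rewrite simple_roots_nth !mxE !eqxx -!val_eqE /=.
have [ij|_] := eqVneq (val i) j.+1; last first.
  by rewrite subr0 eq_sym val_eqE (negPf ji) mulr0.
by rewrite IHm ?mul0r // -ltnS -[j.+1]ij.
Qed.

Lemma coord_simple_root (i j : 'I_n.-1) : coord B i (simple_root K j) = (j == i)%:R.
Proof. by rewrite -simple_roots_nth coord_free ?free_simple_roots. Qed.

Lemma coord_tau_ext (v : 'rV[K]_n) (i : 'I_n.-1) :
  {in G1 &, injective tau} -> i \in G1 ->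
  coord B (tau i) (tau_ext T v) = coord B i v.
Proof.
move=> tau_inj G1i; rewrite linear_sum (bigD1 i) //= linearZ /=.
rewrite coord_simple_root eqxx mulr1 big1 ?addr0 // => j /andP[G1j ji].
rewrite linearZ /= coord_simple_root.
have [/tau_inj tij|_] := eqVneq (tau j) (tau i); last exact: mulr0.
by rewrite tij ?eqxx in ji.
Qed.

Lemma coord_span_G1 (v : 'rV[K]_n) (i : 'I_n.-1) :
  v \in span_G1 K T -> coord B i v != 0 -> i \in G1.
Proof.
move=> vG; apply: contraNT => G1'i; move: vG.
rewrite /span_G1; set s := image _ _; rewrite -[s]/(tval (in_tuple s)) => vs.
rewrite (coord_span vs) linear_sum big1 // => u _; rewrite linearZ /=.
have /imageP[j G1j ->] : s`_u \in s by apply: mem_nth.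
rewrite coord_simple_root; case: eqP => [ji|_]; last exact: mulr0.
by rewrite ji (negPf G1'i) in G1j.
Qed.

Lemma tau_defined_ltn (k : nat) (i j : 'I_n) :
  admissible K T -> (i < j)%N -> tau_defined T k (root_vec K i j) -> (k < n)%N.
Proof.
case=> _ tau_inj _ nilp ltij; set v := root_vec K i j => /forallP vP.
have n_gt0 : (0 < n)%N by apply: leq_ltn_trans (ltn_ord i).
case: k vP => // k vP.
have v_n0 : v != 0.
  apply/eqP => /rowP/(_ i); rewrite !mxE !eqxx /= -val_eqE /= ltn_eqF //.
  by rewrite subr0 => /eqP; rewrite oner_eq0.
have [m vm0] : exists m, coord B m v != 0.
  apply/existsP; apply: contraNT v_n0 => /existsPn H.
  have vB : v \in <<B>>%VS.
    have := vP ord0; apply/subvP/span_subvP => _ /imageP[l _ ->].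
    by rewrite -simple_roots_nth; apply/memv_span/mem_nth; rewrite size_tuple.
  rewrite (coord_span vB); apply/eqP/big1 => l _.
  by have /negPn/eqP -> := H l; rewrite scale0r.
have cm l : (l <= k)%N ->
    coord B (iter l tau m) (iter l (tau_ext T) v) = coord B m v
    /\ iter l tau m \in G1.
  elim: l => [_|l IHl lk].
    by split=> //; apply: coord_span_G1 vm0; have := vP ord0.
  have [IH1 IH2] := IHl (ltnW lk).
  have E : coord B (iter l.+1 tau m) (iter l.+1 (tau_ext T) v) = coord B m v.
    by rewrite /= coord_tau_ext.
  split=> //; apply: (@coord_span_G1 (iter l.+1 (tau_ext T) v)).
    exact: (vP (Ordinal (lk : (l.+1 < k.+1)%N))).
  by rewrite E.
have sG : {subset traject tau m k.+1 <= enum G1}.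
  by move=> _ /trajectP[l lk ->]; rewrite mem_enum; have [] := cm l lk.
suff un : uniq (traject tau m k.+1).
  rewrite -ltn_predRL; have := uniq_leq_size un sG.
  rewrite size_traject -cardE => /leq_trans-> //.
  by rewrite (leq_trans (max_card _)) ?card_ord.
rewrite looping_uniq; apply/negP => loop.
have [l] := nilp m (cm 0 isT).2.
have /loopingP/(_ l) := loop => /trajectP[u lk ->].
by rewrite (cm u (ltnW lk)).2.
Qed.

End Bound.

(* C(r) for r with entries in an algebraically closed field.                  *)
Definition BD_centralizer (L : fieldType) (n : nat) (r : 'M[L]_(n * n))
    (M : 'M[L]_n) : Prop :=
  M \in unitmx /\ Ad2 M r = r.

Definition antidiag_mx (R : pzRingType) (n : nat) : 'M[R]_n :=
  \matrix_(i, j) (i == rev_ord j)%:R.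

Section Unitary.

Variables (K : fieldType) (bar : K -> K) (n : nat).

Definition conjtr (a : 'M[K]_n) : 'M[K]_n := (map_mx bar a)^T.

Definition su (a : 'M[K]_n) : Prop := \tr a = 0 /\ conjtr a + a = 0.

End Unitary.

(* Main.v *)
(* Write [*] for the conjugate transpose on [M_n] and on its tensor square, [R] for
   [(Ad_X (x) Ad_X)(r_BD)], and [r'] for the reflection of [r_BD], the image of [r_BD^*]
   under [Ad_S (x) Ad_S]. The bialgebra condition says that [R^* - R] commutes with the diagonal action of [sl(n)], hence with the swap;
   since [R + R^21] is the Casimir element, [R^* - R] is also antisymmetric under the swap,
   so the condition is [R^* = R], i.e. [(Ad_N (x) Ad_N)(r_BD) = r'] with [N = S X^* X].

   Contraction with the trace form turns [r_BD] and [r'] into operators on [M_n] that are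
   nilpotent on strictly lower and injective on strictly upper triangular matrices. Such
   an [N] intertwines them, so it maps the regular nilpotent [sum E_(i+1,i)] to a strictly
   lower triangular matrix, which makes [N] lower triangular; the transposed argument makes
   it diagonal. Conjugation by a diagonal matrix fixes the Cartan part of [r_BD] and
   rescales the other coordinates by nonzero factors. Hence [r_0] is preserved by
   reflection, and the nonzero coordinates on the [e_alpha (x) e_(-beta)] with simple
   [alpha], [beta], which record when [beta = tau^k(alpha)] for some [k >= 0], show that the
   triple is [s]-symmetric. Conversely, symmetry of [r_0] and of the triple gives
   [r' = r_BD], and then [N] must centralize [r_BD]. *)

From HB Require Import structures.
Require Import Defs.
From mathcomp Require Import all_boot all_order all_fingroup all_algebra.
From mathcomp Require Import all_field.

Set Implicit Arguments.
Unset Strict Implicit.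
Unset Printing Implicit Defensive.

Import GRing.Theory.
Local Open Scope ring_scope.

(** * Coordinates on the tensor square, the swap operator, and contraction *)

Section TensorSquare.

Variables (K : fieldType) (n : nat).
Implicit Types (a b x y X Y : 'M[K]_n) (t u : 'M[K]_(n * n)).

Local Notation "'E_ ( i , j )" := (delta_mx i j : 'M[K]_n)
  (at level 0, format "''E_' ( i ,  j )").

(* The coordinate of [t] on [E_ij (x) E_kl]. *)
Definition tcoord (R : Type) (m : nat) (t : 'M[R]_(m * m)) (i j k l : 'I_m) : R :=
  t (mxtens_index (i, k)) (mxtens_index (j, l)).

Lemma tcoordP (R : Type) (m : nat) (t u : 'M[R]_(m * m)) :
  (forall i j k l, tcoord t i j k l = tcoord u i j k l) -> t = u.
Proof.
move=> tu; apply/matrixP => p q.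
by case: (mxtens_indexP p) (mxtens_indexP q) => i k [j l]; apply: tu.
Qed.

Lemma tcoord_tens a b i j k l : tcoord (a *t b) i j k l = a i j * b k l.
Proof. exact: tensmxE. Qed.

Lemma tcoordD t u i j k l :
  tcoord (t + u) i j k l = tcoord t i j k l + tcoord u i j k l.
Proof. by rewrite /tcoord mxE. Qed.

Lemma tcoordB t u i j k l :
  tcoord (t - u) i j k l = tcoord t i j k l - tcoord u i j k l.
Proof. by rewrite /tcoord !mxE. Qed.

Lemma tcoordZ c t i j k l : tcoord (c *: t) i j k l = c * tcoord t i j k l.
Proof. by rewrite /tcoord mxE. Qed.

Lemma tcoord0 i j k l : tcoord (0 : 'M[K]_(n * n)) i j k l = 0.
Proof. by rewrite /tcoord mxE. Qed.

Lemma tcoord_sum I (r : seq I) (P : pred I) (F : I -> 'M[K]_(n * n)) i j k l :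
  tcoord (\sum_(s <- r | P s) F s) i j k l =
  \sum_(s <- r | P s) tcoord (F s) i j k l.
Proof. exact: summxE. Qed.

Lemma tcoord_tr t i j k l : tcoord t^T i j k l = tcoord t j i l k.
Proof. by rewrite /tcoord mxE. Qed.

Lemma tensmxDl a b x : (a + b) *t x = a *t x + b *t x.
Proof. by apply: tcoordP => *; rewrite tcoordD !tcoord_tens !mxE mulrDl. Qed.

Lemma tensmxDr a b x : x *t (a + b) = x *t a + x *t b.
Proof. by apply: tcoordP => *; rewrite tcoordD !tcoord_tens !mxE mulrDr. Qed.

Lemma tensmxZl c a x : (c *: a) *t x = c *: (a *t x).
Proof. by apply: tcoordP => *; rewrite tcoordZ !tcoord_tens !mxE mulrA. Qed.

Lemma tensmxZr c a x : x *t (c *: a) = c *: (x *t a).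
Proof. by apply: tcoordP => *; rewrite tcoordZ !tcoord_tens !mxE mulrCA. Qed.

Lemma tensmxNl a x : (- a) *t x = - (a *t x).
Proof. by rewrite -scaleN1r tensmxZl scaleN1r. Qed.

Lemma tensmxNr a x : x *t (- a) = - (x *t a).
Proof. by rewrite -scaleN1r tensmxZr scaleN1r. Qed.

Lemma tensmxBl a b x : (a - b) *t x = a *t x - b *t x.
Proof. by rewrite tensmxDl tensmxNl. Qed.

Lemma tensmxBr a b x : x *t (a - b) = x *t a - x *t b.
Proof. by rewrite tensmxDr tensmxNr. Qed.

Lemma tensmx11 : (1%:M : 'M[K]_n) *t (1%:M : 'M[K]_n) = 1%:M.
Proof.
apply: tcoordP => i j k l; rewrite tcoord_tens /tcoord !mxE.
by rewrite (can_eq (@mxtens_indexK n n)) xpair_eqE -mulnb natrM.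
Qed.

Lemma tens_expand t :
  t = \sum_i \sum_j \sum_k \sum_l tcoord t i j k l *: ('E_(i, j) *t 'E_(k, l)).
Proof.
apply: tcoordP => i j k l.
rewrite tcoord_sum (bigD1 i) //= tcoord_sum (bigD1 j) //= tcoord_sum (bigD1 k) //=.
rewrite tcoord_sum (bigD1 l) //= tcoordZ tcoord_tens !mxE !eqxx !mulr1.
rewrite !big1 ?addr0 //.
- move=> i' ii'; rewrite tcoord_sum big1 // => j' _; rewrite tcoord_sum big1 // => k' _.
  rewrite tcoord_sum big1 // => l' _; rewrite tcoordZ tcoord_tens !mxE.
  by rewrite [i == _]eq_sym (negPf ii') !(mul0r, mulr0).
- move=> j' jj'; rewrite tcoord_sum big1 // => k' _.
  rewrite tcoord_sum big1 // => l' _; rewrite tcoordZ tcoord_tens !mxE.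
  by rewrite [j == _]eq_sym (negPf jj') andbF !(mul0r, mulr0).
- move=> k' kk'; rewrite tcoord_sum big1 // => l' _; rewrite tcoordZ tcoord_tens !mxE.
  by rewrite [k == _]eq_sym (negPf kk') !(mul0r, mulr0).
- move=> l' ll'; rewrite tcoordZ tcoord_tens !mxE.
  by rewrite [l == _]eq_sym (negPf ll') andbF !(mul0r, mulr0).
Qed.

Lemma Ad2E X t : Ad2 X t = (X *t X) *m t *m (invmx X *t invmx X).
Proof.
rewrite {2}[t]tens_expand /Ad2 /tens_map /tens_lift mulmx_sumr mulmx_suml.
apply: eq_bigr => i _; rewrite mulmx_sumr mulmx_suml; apply: eq_bigr => j _.
rewrite mulmx_sumr mulmx_suml; apply: eq_bigr => k _.
rewrite mulmx_sumr mulmx_suml; apply: eq_bigr => l _.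
by rewrite -scalemxAr -scalemxAl !tensmx_mul.
Qed.

Lemma Ad2_tens X a b : Ad2 X (a *t b) = Ad X a *t Ad X b.
Proof. by rewrite Ad2E !tensmx_mul. Qed.

Lemma Ad2D X t u : Ad2 X (t + u) = Ad2 X t + Ad2 X u.
Proof. by rewrite !Ad2E mulmxDr mulmxDl. Qed.

Lemma invmx_mul X Y :
  X \in unitmx -> Y \in unitmx -> invmx (X *m Y) = invmx Y *m invmx X.
Proof.
move=> Xu Yu; have XYu : X *m Y \in unitmx by rewrite unitmx_mul Xu.
by rewrite -[RHS](mulKmx XYu) -!mulmxA mulKVmx // mulmxV // mulmx1.
Qed.

Lemma Ad2M X Y t : X \in unitmx -> Y \in unitmx -> Ad2 X (Ad2 Y t) = Ad2 (X *m Y) t.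
Proof.
move=> Xu Yu; rewrite !Ad2E !mulmxA tensmx_mul -!mulmxA tensmx_mul.
by rewrite invmx_mul.
Qed.

Lemma Ad2_1 t : Ad2 1%:M t = t.
Proof. by rewrite Ad2E invmx1 tensmx11 mul1mx mulmx1. Qed.

Lemma Ad2K X t : X \in unitmx -> Ad2 (invmx X) (Ad2 X t) = t.
Proof. by move=> Xu; rewrite Ad2M ?unitmx_inv // mulVmx // Ad2_1. Qed.

Lemma Ad2Kinv X t : X \in unitmx -> Ad2 X (Ad2 (invmx X) t) = t.
Proof. by move=> Xu; rewrite Ad2M ?unitmx_inv // mulmxV // Ad2_1. Qed.

Lemma tcoord_flip t i j k l : tcoord (tens_flip t) i j k l = tcoord t k l i j.
Proof.
rewrite [in RHS](tens_expand t) /tens_flip /tens_lift !tcoord_sum.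
apply: eq_bigr => i' _; rewrite !tcoord_sum; apply: eq_bigr => j' _.
rewrite !tcoord_sum; apply: eq_bigr => k' _.
rewrite !tcoord_sum; apply: eq_bigr => l' _.
by rewrite !tcoordZ !tcoord_tens; congr (_ * _); rewrite mulrC.
Qed.

Lemma tens_flipD t u : tens_flip (t + u) = tens_flip t + tens_flip u.
Proof. by apply: tcoordP => *; rewrite !(tcoord_flip, tcoordD). Qed.

Lemma tens_flipB t u : tens_flip (t - u) = tens_flip t - tens_flip u.
Proof. by apply: tcoordP => *; rewrite !(tcoord_flip, tcoordB). Qed.

Lemma tens_flip_tens a b : tens_flip (a *t b) = b *t a.
Proof. by apply: tcoordP => *; rewrite tcoord_flip !tcoord_tens mulrC. Qed.

(** The permutation operator on the tensor square of [K^n]. Conjugation by it is [tens_flip], and up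
    to a scalar matrix it is the Casimir element. *)
Definition tens_swap : 'M[K]_(n * n) :=
  \sum_i \sum_j 'E_(i, j) *t 'E_(j, i).

Lemma tcoord_swap i j k l : tcoord tens_swap i j k l = ((i == l) && (k == j))%:R.
Proof.
rewrite /tens_swap tcoord_sum (bigD1 i) //= tcoord_sum (bigD1 j) //=.
rewrite tcoord_tens !mxE !eqxx mul1r [X in _ + X]big1 ?addr0 => [|u ui].
  rewrite [X in _ + X]big1 ?addr0 => [|v vj]; first by rewrite andbC [i == l]eq_sym.
  by rewrite tcoord_tens mxE [j == v]eq_sym (negPf vj) andbF mul0r.
rewrite tcoord_sum big1 // => v _.
by rewrite tcoord_tens mxE [i == u]eq_sym (negPf ui) mul0r.
Qed.

Lemma tcoord_mul t u i j k l :
  tcoord (t *m u) i j k l = \sum_p \sum_q tcoord t i p k q * tcoord u p j q l.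
Proof.
rewrite /tcoord mxE (reindex (@mxtens_index n n)) /=; last first.
  by exists (@mxtens_unindex n n) => ? _; rewrite ?mxtens_indexK ?mxtens_unindexK.
by rewrite pair_bigA; apply: eq_bigr => -[p q] _.
Qed.

Lemma tcoord_swapl t i j k l : tcoord (tens_swap *m t) i j k l = tcoord t k j i l.
Proof.
rewrite tcoord_mul (bigD1 k) //= (bigD1 i) //= tcoord_swap !eqxx mul1r.
rewrite !big1 ?addr0 // => [p pk|q qi].
  by rewrite big1 // => q _; rewrite tcoord_swap [k == p]eq_sym (negPf pk) andbF mul0r.
by rewrite tcoord_swap [i == q]eq_sym (negPf qi) mul0r.
Qed.

Lemma tcoord_swapr t i j k l : tcoord (t *m tens_swap) i j k l = tcoord t i l k j.
Proof.
rewrite tcoord_mul (bigD1 l) //= (bigD1 j) //= tcoord_swap !eqxx mulr1.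
rewrite !big1 ?addr0 // => [p pk|q qi].
  by rewrite big1 // => q _; rewrite tcoord_swap (negPf pk) mulr0.
by rewrite tcoord_swap (negPf qi) andbF mulr0.
Qed.

Lemma tens_flip_swap t : tens_flip t = tens_swap *m t *m tens_swap.
Proof. by apply: tcoordP => *; rewrite tcoord_flip tcoord_swapr tcoord_swapl. Qed.

Lemma tens_flip_comm t : t *m tens_swap = tens_swap *m t -> tens_flip t = t.
Proof.
move=> tP; apply: tcoordP => i j k l.
by rewrite tcoord_flip -tcoord_swapr tP tcoord_swapl.
Qed.

Lemma casimir_swap : casimir K n = tens_swap - n%:R^-1 *: 1%:M.
Proof. by rewrite /casimir tensmx11. Qed.

Lemma swap_tens a b : tens_swap *m (a *t b) = (b *t a) *m tens_swap.
Proof.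
by apply: tcoordP => *; rewrite tcoord_swapl tcoord_swapr !tcoord_tens mulrC.
Qed.

(** The swap commutes with [X *t X], and the rest of the Casimir element is a scalar. *)
Lemma Ad2_casimir X : X \in unitmx -> Ad2 X (casimir K n) = casimir K n.
Proof.
move=> Xu; rewrite Ad2E casimir_swap mulmxBr mulmxBl -swap_tens -(mulmxA tens_swap).
rewrite tensmx_mul mulmxV // tensmx11 mulmx1; congr (_ - _).
by rewrite -scalemxAr -scalemxAl mulmx1 tensmx_mul mulmxV // tensmx11.
Qed.

Lemma Ad2_flip X t : tens_flip (Ad2 X t) = Ad2 X (tens_flip t).
Proof.
rewrite !Ad2E !tens_flip_swap !mulmxA swap_tens -!mulmxA -swap_tens; congr (_ *m _).
Qed.

(* [contract t x] applies to the second factor of [t] the form dual to [x] for the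
   trace form. *)
Definition contract t x : 'M[K]_n :=
  \matrix_(i, j) \sum_k \sum_l tcoord t i j k l * x l k.

Lemma contract_tens a b x : contract (a *t b) x = \tr (b *m x) *: a.
Proof.
apply/matrixP => i j; rewrite !mxE /mxtrace mulr_suml; apply: eq_bigr => k _.
rewrite mxE mulr_suml; apply: eq_bigr => l _.
by rewrite tcoord_tens -mulrA mulrC.
Qed.

Lemma contract_linear t : linear (contract t).
Proof.
move=> c x y; apply/matrixP => i j; rewrite !mxE mulr_sumr -big_split.
apply: eq_bigr => k _; rewrite mulr_sumr -big_split; apply: eq_bigr => l _.
by rewrite !mxE mulrDr mulrCA.
Qed.

HB.instance Definition _ t :=
  GRing.isLinear.Build K 'M[K]_n 'M[K]_n _ (contract t) (contract_linear t).

Lemma contractD t u x : contract (t + u) x = contract t x + contract u x.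
Proof.
apply/matrixP => i j; rewrite !mxE -big_split; apply: eq_bigr => k _.
by rewrite -big_split; apply: eq_bigr => l _; rewrite tcoordD mulrDl.
Qed.

Lemma contractZ c t x : contract (c *: t) x = c *: contract t x.
Proof.
apply/matrixP => i j; rewrite !mxE mulr_sumr; apply: eq_bigr => k _.
by rewrite mulr_sumr; apply: eq_bigr => l _; rewrite tcoordZ mulrA.
Qed.

Lemma contract0 x : contract 0 x = 0.
Proof. by rewrite -(scale0r (0 : 'M[K]_(n * n))) contractZ scale0r. Qed.

Lemma contract_sum I (r : seq I) (P : pred I) (F : I -> 'M[K]_(n * n)) x :
  contract (\sum_(s <- r | P s) F s) x = \sum_(s <- r | P s) contract (F s) x.
Proof.
elim/big_rec2: _ => [|s y t _ <-]; first exact: contract0.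
exact: contractD.
Qed.

(** The trace form is invariant under conjugation, so contraction is equivariant. This turns a gauge
    transformation of tensors into an intertwiner of operators on matrices. *)
Lemma contract_Ad2 X t x :
  X \in unitmx -> contract (Ad2 X t) (Ad X x) = Ad X (contract t x).
Proof.
move=> Xu; have AdD : forall I (r : seq I) (F : I -> 'M[K]_n),
  Ad X (\sum_(i <- r) F i) = \sum_(i <- r) Ad X (F i).
  by move=> I r F; rewrite /Ad mulmx_sumr mulmx_suml.
rewrite {2}[t]tens_expand /Ad2 /tens_map /tens_lift !contract_sum AdD.
apply: eq_bigr => i _; rewrite !contract_sum AdD; apply: eq_bigr => j _.
rewrite !contract_sum AdD; apply: eq_bigr => k _.
rewrite !contract_sum AdD; apply: eq_bigr => l _.
rewrite !contractZ !contract_tens /Ad -!scalemxAr -!scalemxAl.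
by rewrite -!mulmxA mulKmx // mxtrace_mulC -!mulmxA mulVmx // mulmx1.
Qed.

(** Flipping a tensor replaces its contraction operator by the adjoint for the trace form;
    nilpotency is transported between triangular parts this way. *)
Lemma contract_flip t x y :
  \tr (contract (tens_flip t) x *m y) = \tr (x *m contract t y).
Proof.
have tr2 (a b : 'M[K]_n) : \tr (a *m b) = \sum_i \sum_j a i j * b j i.
  by apply: eq_bigr => i _; rewrite mxE.
rewrite !tr2; transitivity (\sum_i \sum_j \sum_k \sum_l x l k * tcoord t k l i j * y j i).
  apply: eq_bigr => i _; apply: eq_bigr => j _; rewrite mxE mulr_suml.
  apply: eq_bigr => k _; rewrite mulr_suml; apply: eq_bigr => l _.
  by rewrite tcoord_flip [x _ _ * _]mulrC.
transitivity (\sum_l \sum_k \sum_i \sum_j x l k * tcoord t k l i j * y j i); last first.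
  apply: eq_bigr => l _; apply: eq_bigr => k _; rewrite mxE mulr_sumr.
  by apply: eq_bigr => i _; rewrite mulr_sumr; apply: eq_bigr => j _; rewrite mulrA.
transitivity (\sum_i \sum_l \sum_k \sum_j x l k * tcoord t k l i j * y j i).
  apply: eq_bigr => i _; under eq_bigr => j _ do rewrite exchange_big.
  rewrite exchange_big; apply: eq_bigr => l _; exact: exchange_big.
rewrite exchange_big; apply: eq_bigr => l _; exact: exchange_big.
Qed.

(** On trace-zero matrices this operator is the identity, so [t + tens_flip t = casimir] says that
    there [contract t] and its adjoint add up to the identity. *)
Lemma contract_casimir x : contract (casimir K n) x = x - (\tr x / n%:R)%:M.
Proof.
rewrite casimir_swap contractD -scaleN1r scalerA contractZ -tensmx11 contract_tens.
rewrite mul1mx scale_scalar_mx mulr1 -[X in _ + X]scalerA.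
congr (_ + _); last by rewrite scaleN1r scale_scalar_mx mulrC.
apply/matrixP => i j; rewrite mxE (bigD1 j) //= (bigD1 i) //= tcoord_swap !eqxx mul1r.
rewrite !big1 ?addr0 // => [k kj|l li].
  by rewrite big1 // => l _; rewrite tcoord_swap (negPf kj) andbF mul0r.
by rewrite tcoord_swap [i == l]eq_sym (negPf li) mul0r.
Qed.

End TensorSquare.

(** * Tensor squares of subspaces and the diagonal action *)

Section TensorSubspaces.

Variables (K : fieldType) (n : nat).
Implicit Types (V W : 'M[K]_n -> Prop) (a b X : 'M[K]_n) (t u : 'M[K]_(n * n)).

Lemma tens_sub_ind V (P : 'M[K]_(n * n) -> Prop) :
    P 0 -> (forall t u, P t -> P u -> P (t + u)) ->
    (forall a b, V a -> V b -> P (a *t b)) ->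
  forall t, tens_sub V t -> P t.
Proof.
move=> P0 PD PV _ [s [sV ->]]; elim: s sV => [_|p s IHs sV]; first by rewrite big_nil.
rewrite big_cons; apply: PD; first by have [Vp1 Vp2] := sV p (mem_head _ _); apply: PV.
by apply: IHs => q qs; apply: sV; rewrite inE qs orbT.
Qed.

Lemma tens_sub0 V : tens_sub V 0.
Proof. by exists [::]; rewrite big_nil. Qed.

Lemma tens_subD V t u : tens_sub V t -> tens_sub V u -> tens_sub V (t + u).
Proof.
move=> [s [sV ->]] [s' [s'V ->]]; exists (s ++ s'); rewrite big_cat; split=> // p.
by rewrite mem_cat => /orP[/sV|/s'V].
Qed.

Lemma tens_sub_tens V a b : V a -> V b -> tens_sub V (a *t b).
Proof.
by move=> Va Vb; exists [:: (a, b)]; rewrite big_seq1; split=> // p; rewrite inE => /eqP->.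
Qed.

Lemma tens_sub_sum V I (r : seq I) (P : pred I) (F : I -> 'M[K]_(n * n)) :
  (forall i, P i -> tens_sub V (F i)) -> tens_sub V (\sum_(i <- r | P i) F i).
Proof.
by move=> FV; elim/big_ind: _ => [|t u|i Pi]; [exact: tens_sub0|exact: tens_subD|exact: FV].
Qed.

Lemma tens_subS V W t : (forall a, V a -> W a) -> tens_sub V t -> tens_sub W t.
Proof.
move=> VW; elim/tens_sub_ind => *; [exact: tens_sub0|exact: tens_subD|].
by apply: tens_sub_tens; apply: VW.
Qed.

Definition sl a : Prop := \tr a = 0.

Lemma sl_Ad X a : X \in unitmx -> sl a -> sl (Ad X a).
Proof. by move=> Xu; rewrite /sl /Ad mxtrace_mulC mulmxA mulVmx // mul1mx. Qed.

Lemma sl_br a b : sl (lie_br a b).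
Proof. by rewrite /sl linearB /= mxtrace_mulC subrr. Qed.

Lemma tens_sub_sl_Ad2 X t :
  X \in unitmx -> tens_sub sl t -> tens_sub sl (Ad2 X t).
Proof.
move=> Xu; elim/tens_sub_ind => [|*|a b sa sb].
- by rewrite Ad2E mulmx0 mul0mx; apply: tens_sub0.
- by rewrite Ad2D; apply: tens_subD.
- by rewrite Ad2_tens; apply: tens_sub_tens; apply: sl_Ad.
Qed.

Definition diag_act a : 'M[K]_(n * n) := a *t (1%:M : 'M[K]_n) + (1%:M : 'M[K]_n) *t a.

Lemma coboundaryE t a : coboundary t a = t *m diag_act a - diag_act a *m t.
Proof. by []. Qed.

(** The diagonal action is a derivation on pure tensors, and every commutator has trace zero,
    whatever the trace of [a]. *)
Lemma tens_sub_sl_coboundary t a : tens_sub sl t -> tens_sub sl (coboundary t a).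
Proof.
elim/tens_sub_ind => [|t1 t2 IH1 IH2|x y sx sy].
- by rewrite coboundaryE mul0mx mulmx0 subrr; apply: tens_sub0.
- suff -> : coboundary (t1 + t2) a = coboundary t1 a + coboundary t2 a.
    exact: tens_subD.
  by rewrite !coboundaryE (mulmxDl t1) (mulmxDr _ t1) opprD addrACA.
- suff -> : coboundary (x *t y) a = lie_br x a *t y + x *t lie_br y a.
    by apply: tens_subD; apply: tens_sub_tens => //; apply: sl_br.
  rewrite coboundaryE /diag_act /lie_br mulmxDl mulmxDr !tensmx_mul !mulmx1 !mul1mx.
  by rewrite tensmxBl tensmxBr opprD addrACA.
Qed.

Lemma diag_actD a b : diag_act (a + b) = diag_act a + diag_act b.
Proof. by rewrite /diag_act tensmxDl tensmxDr addrACA. Qed.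

Lemma diag_actZ c a : diag_act (c *: a) = c *: diag_act a.
Proof. by rewrite /diag_act tensmxZl tensmxZr scalerDr. Qed.

(* [a (x) b + b (x) a = d(a) d(b) - d(ab)] for [d = diag_act], and these elements
   for matrix units add up to twice the swap. *)
Lemma diag_act_commutant t :
    2%:R != 0 :> K -> (forall a, t *m diag_act a = diag_act a *m t) ->
  tens_flip t = t.
Proof.
move=> n2 tC; apply: tens_flip_comm.
have tC2 a b : t *m (a *t b + b *t a) = (a *t b + b *t a) *m t.
  have -> : a *t b + b *t a = diag_act a *m diag_act b - diag_act (a *m b).
    rewrite /diag_act mulmxDl !mulmxDr !tensmx_mul !mulmx1 !mul1mx.
    by rewrite (addrC ((a *m b) *t _)) addrACA addrK.
  by rewrite mulmxBr mulmxBl tC mulmxA tC -!mulmxA tC.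
have swap2 : 2%:R *: tens_swap K n =
    \sum_i \sum_j ((delta_mx i j : 'M[K]_n) *t delta_mx j i
                   + (delta_mx j i : 'M[K]_n) *t delta_mx i j).
  under [RHS]eq_bigr => i _ do rewrite big_split.
  rewrite big_split /= scaler_nat mulr2n; congr (_ + _).
  exact: exchange_big.
apply: (scalerI n2); rewrite scalemxAr scalemxAl swap2 mulmx_sumr mulmx_suml.
apply: eq_bigr => i _; rewrite mulmx_sumr mulmx_suml; apply: eq_bigr => j _.
exact: tC2.
Qed.

End TensorSubspaces.

Arguments sl {K n}.

(** * The conjugate transpose on matrices and tensors *)

Section ConjTranspose.

Variables (K : fieldType) (bar : {rmorphism K -> K}) (n : nat).
Hypothesis barK : involutive bar.
Implicit Types (a b X : 'M[K]_n) (c : K).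

Lemma conjtrD a b : conjtr bar (a + b) = conjtr bar a + conjtr bar b.
Proof. by apply/matrixP => i j; rewrite !mxE rmorphD. Qed.

Lemma conjtrB a b : conjtr bar (a - b) = conjtr bar a - conjtr bar b.
Proof. by apply/matrixP => i j; rewrite !mxE rmorphB. Qed.

Lemma conjtrZ c a : conjtr bar (c *: a) = bar c *: conjtr bar a.
Proof. by apply/matrixP => i j; rewrite !mxE rmorphM. Qed.

Lemma conjtr1 : conjtr bar (1%:M : 'M[K]_n) = 1%:M.
Proof. by rewrite /conjtr map_mx1 trmx1. Qed.

Lemma conjtrM a b : conjtr bar (a *m b) = conjtr bar b *m conjtr bar a.
Proof. by rewrite /conjtr map_mxM trmx_mul. Qed.

Lemma conjtrK : involutive (@conjtr K bar n).
Proof. by move=> a; apply/matrixP => i j; rewrite !mxE barK. Qed.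

Lemma conjtr_unit a : (conjtr bar a \in unitmx) = (a \in unitmx).
Proof. by rewrite /conjtr unitmx_tr map_unitmx. Qed.

Lemma conjtr_inv a : conjtr bar (invmx a) = invmx (conjtr bar a).
Proof. by rewrite /conjtr map_invmx trmx_inv. Qed.

Lemma mxtrace_conjtr a : \tr (conjtr bar a) = bar (\tr a).
Proof. by rewrite /conjtr mxtrace_tr; apply: esym; rewrite /mxtrace rmorph_sum;
  apply: eq_bigr => i _; rewrite mxE. Qed.

Lemma conjtr_tens a b : conjtr bar (a *t b) = conjtr bar a *t conjtr bar b.
Proof. by rewrite /conjtr map_mxT trmx_tens. Qed.

Lemma tcoord_conjtr (t : 'M[K]_(n * n)) i j k l :
  tcoord (conjtr bar t) i j k l = bar (tcoord t j i l k).
Proof. by rewrite /tcoord !mxE. Qed.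

End ConjTranspose.

(** * The unitary form of [sl(n)] and the bialgebra condition *)

Section SpecialUnitary.

Variables (K : fieldType) (bar : {rmorphism K -> K}) (n : nat) (dl : K).
Hypotheses (barK : involutive bar) (bar_dl : bar dl = - dl) (dl_n0 : dl != 0).
Hypotheses (two_n0 : 2%:R != 0 :> K) (n_n0 : n%:R != 0 :> K).
Implicit Types (a b X : 'M[K]_n) (t r : 'M[K]_(n * n)).

Local Notation su := (su bar (n := n)).
Local Notation star := (conjtr bar).

Lemma suE a : su a <-> sl a /\ star a = - a.
Proof.
split=> -[ta]; first by move/eqP; rewrite addr_eq0 => /eqP.
by move=> E; split=> //; rewrite -[LHS]/(star a + a) E addNr.
Qed.

Lemma bar_half : bar 2%:R^-1 = 2%:R^-1.
Proof. by rewrite fmorphV rmorph_nat. Qed.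

(** Take the skew-Hermitian and Hermitian parts of [a]. Since [bar] negates [dl], dividing the
    Hermitian part by [dl] makes it skew-Hermitian. *)
Lemma sl_su_decomp a : sl a -> exists b c, [/\ su b, su c & a = b + dl *: c].
Proof.
move=> ta; have tsa : \tr (star a) = 0 by rewrite mxtrace_conjtr ta rmorph0.
exists (2%:R^-1 *: (a - star a)), ((2%:R * dl)^-1 *: (a + star a)); split.
- apply/suE; split; first by rewrite /sl linearZ linearB /= ta tsa subr0 mulr0.
  by rewrite conjtrZ conjtrB conjtrK // bar_half -scalerN opprB.
- apply/suE; split; first by rewrite /sl linearZ linearD /= ta tsa addr0 mulr0.
  rewrite conjtrZ conjtrD conjtrK // fmorphV rmorphM rmorph_nat bar_dl mulrN invrN.
  by rewrite scaleNr [star a + a]addrC.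
- rewrite scalerA invfM mulrCA mulfV // mulr1 -scalerDr addrACA addNr addr0.
  by rewrite -mulr2n -scaler_nat scalerA mulVf // scale1r.
Qed.

Lemma conjtr_tens_su t : tens_sub su t -> star t = t.
Proof.
elim/tens_sub_ind => [|t1 t2 IH1 IH2|a b /suE[_ sa] /suE[_ sb]].
- by rewrite /conjtr map_mx0 trmx0.
- by rewrite conjtrD IH1 IH2.
- by rewrite conjtr_tens sa sb tensmxNl tensmxNr opprK.
Qed.

(** Galois descent for the tensor square: write [t = A + dl *: B] with [A], [B] in the unitary form.
    Both are fixed by [star] because two signs cancel, while [dl] is negated, so a fixed [t] has
    [dl *: B = 0]. *)
Lemma tens_sub_suP t : tens_sub su t <-> tens_sub sl t /\ star t = t.
Proof.
split=> [st|[]].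
  by split; [apply: tens_subS st => a [] | apply: conjtr_tens_su].
(* The factor [dl ^+ 2] arises from the product of the two [dl]-components, and it is fixed by
   [bar]. *)
have suN a : su a -> su ((dl ^+ 2) *: a).
  move=> /suE[ta sa]; apply/suE; split; first by rewrite /sl linearZ /= ta mulr0.
  by rewrite conjtrZ rmorphXn bar_dl sqrrN sa scalerN.
move=> st tt.
suff [A [B [sA sB AB]]] : exists A B, [/\ tens_sub su A, tens_sub su B & t = A + dl *: B].
  have {}tt : A + dl *: B = A - dl *: B.
    by rewrite -{1}AB -tt AB conjtrD conjtrZ bar_dl !conjtr_tens_su // scaleNr.
  have B0 : 2%:R *: (dl *: B) = 0.
    by rewrite scaler_nat mulr2n; apply/eqP; rewrite addr_eq0; apply/eqP/(addrI A).
  by move/eqP: B0; rewrite AB scaler_eq0 (negPf two_n0) => /eqP->; rewrite addr0.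
elim/tens_sub_ind: {tt} st => [|t1 t2 IH1 IH2|a b sa sb].
- by exists 0, 0; split; rewrite ?scaler0 ?addr0 //; apply: tens_sub0.
- have [A1 [B1 [sA1 sB1 ->]]] := IH1; have [A2 [B2 [sA2 sB2 ->]]] := IH2.
  exists (A1 + A2), (B1 + B2); split; [exact: tens_subD | exact: tens_subD|].
  by rewrite scalerDr addrACA.
- have [a1 [a2 [sa1 sa2 ->]]] := sl_su_decomp sa.
  have [b1 [b2 [sb1 sb2 ->]]] := sl_su_decomp sb.
  exists (a1 *t b1 + (dl ^+ 2 *: a2) *t b2), (a1 *t b2 + a2 *t b1); split.
  - by apply: tens_subD; apply: tens_sub_tens => //; apply: suN.
  - by apply: tens_subD; apply: tens_sub_tens.
  - rewrite tensmxDl !tensmxDr !tensmxZl !tensmxZr expr2 !scalerDr !scalerA.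
    by rewrite [RHS]addrACA; congr (_ + _); rewrite addrC.
Qed.

Lemma star_casimir : star (casimir K n) = casimir K n.
Proof.
rewrite casimir_swap conjtrB conjtrZ conjtr1 fmorphV rmorph_nat; congr (_ - _).
by apply: tcoordP => i j k l; rewrite tcoord_conjtr !tcoord_swap rmorph_nat andbC
  [l == i]eq_sym [k == j]eq_sym // andbC.
Qed.

(* [r^* - r] commutes with the diagonal action of [sl(n)], so it is symmetric; it is
   also antisymmetric, because the symmetric part of [r] is determined by the Casimir. *)
Lemma su_bialgebraP r : tens_sub sl r -> r + tens_flip r = casimir K n ->
  defines_Lie_bialgebra su r <-> star r = r.
Proof.
move=> sr rC.
have star_act a : su a -> star (diag_act a) = - diag_act a.
  move=> /suE[_ sa]; rewrite /diag_act conjtrD !conjtr_tens sa conjtr1.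
  by rewrite tensmxNl tensmxNr opprD.
have star_cob a : su a -> star (coboundary r a) = coboundary (star r) a.
  move=> sa; rewrite !coboundaryE conjtrB !conjtrM star_act //.
  by rewrite mulNmx mulmxN opprK addrC.
split=> [H|rr a sa]; last first.
  by apply/tens_sub_suP; rewrite star_cob // rr; split=> //; apply: tens_sub_sl_coboundary.
pose u := star r - r.
have uC_su a : su a -> u *m diag_act a = diag_act a *m u.
  move=> sa; have /tens_sub_suP[_] := H a sa; rewrite star_cob // !coboundaryE.
  move=> /eqP; rewrite /u mulmxBl mulmxBr.
  move=> /eqP E; apply/eqP; rewrite -subr_eq0; apply/eqP;
    rewrite -(subrr (r *m diag_act a - diag_act a *m r)) -{1}E.
  by rewrite !opprB [RHS]addrACA [LHS]addrACA; congr (_ + _); rewrite addrC.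
(* The commutation is [K]-linear in [a], and the unitary form spans [sl(n)] over [K]. *)
have uC_sl a : sl a -> u *m diag_act a = diag_act a *m u.
  move=> /sl_su_decomp[b [c [sb sc ->]]].
  by rewrite diag_actD diag_actZ (mulmxDr u) (mulmxDl (diag_act b)) -scalemxAr -scalemxAl
    !uC_su.
(* Split off the trace: a scalar matrix acts diagonally by a scalar, which is central. *)
have uC a : u *m diag_act a = diag_act a *m u.
  have -> : a = (a - (\tr a / n%:R)%:M) + (\tr a / n%:R)%:M by rewrite subrK.
  rewrite diag_actD (mulmxDr u) (mulmxDl (diag_act _)) uC_sl; last first.
    by rewrite /sl linearB /= mxtrace_scalar -[X in _ - X]mulr_natr divfK // subrr.
  congr (_ + _); rewrite -scalemx1 diag_actZ -scalemxAr -scalemxAl; congr (_ *: _).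
  by rewrite /diag_act tensmx11 (mulmxDr u) (mulmxDl 1%:M) mulmx1 mul1mx.
have usym := diag_act_commutant two_n0 uC.
have star_flip : tens_flip (star r) = star (tens_flip r).
  by apply: tcoordP => *; rewrite !(tcoord_flip, tcoord_conjtr).
have uanti : u + tens_flip u = 0.
  by rewrite /u tens_flipB addrACA star_flip -conjtrD -opprD rC star_casimir subrr.
have : 2%:R *: u = 0 by rewrite scaler_nat mulr2n -{2}usym.
by move/eqP; rewrite scaler_eq0 (negPf two_n0) subr_eq0 => /eqP.
Qed.

End SpecialUnitary.

(** * Triangular and nilpotent matrices *)

Section Triangular.

Variables (K : fieldType) (n : nat).
Implicit Types (x y : 'M[K]_n) (t : 'M[K]_(n * n)).

Definition strictly_lower x := forall i j : 'I_n, (i <= j)%N -> x i j = 0.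
Definition strictly_upper x := forall i j : 'I_n, (j <= i)%N -> x i j = 0.
Definition upper_part x : 'M[K]_n := \matrix_(i, j) if (i < j)%N then x i j else 0.

Lemma upper_part_strictly_upper x : strictly_upper (upper_part x).
Proof. by move=> i j; rewrite mxE leqNgt => /negPf->. Qed.

Lemma upper_part_id x : strictly_upper x -> upper_part x = x.
Proof.
move=> ux; apply/matrixP => i j; rewrite mxE; case: ltnP => // ji.
by rewrite ux.
Qed.

Lemma strictly_lower_tr x : strictly_lower x -> strictly_upper x^T.
Proof. by move=> lx i j ij; rewrite mxE lx. Qed.

Lemma strictly_lower_nilp x : strictly_lower x -> x ^+ n = 0.
Proof.
(* Each further factor pushes the support one diagonal down; after [n] factors nothing is left. *)
move=> lx; suff xk k (i j : 'I_n) : (i < j + k)%N -> (x ^+ k) i j = 0.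
  by apply/matrixP => i j; rewrite mxE xk // ltn_addl.
elim: k i j => [|k IHk] i j ij.
  by move: ij; rewrite addn0 expr0 mxE -val_eqE => /ltn_eqF->.
rewrite exprS mxE big1 // => p _; have [ip|pi] := leqP i p; first by rewrite lx ?mul0r.
by rewrite IHk ?mulr0 // -ltnS -addnS (leq_trans _ ij).
Qed.

(** For a lower triangular matrix the diagonal entries of a power are the powers of the diagonal
    entries, so nilpotency makes them vanish. *)
Lemma nilp_lower_diag0 x :
  (forall i j : 'I_n, (i < j)%N -> x i j = 0) -> x ^+ n = 0 -> strictly_lower x.
Proof.
move=> lx xn i j; rewrite leq_eqVlt => /orP[/eqP/val_inj<-|/lx //].
have xk k : (forall i j : 'I_n, (i < j)%N -> (x ^+ k) i j = 0)
    /\ (x ^+ k) i i = x i i ^+ k.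
  elim: k => [|k [IH1 IH2]].
    by rewrite !expr0; split=> [p q pq|]; rewrite mxE ?eqxx // -val_eqE ltn_eqF.
  rewrite !exprS; split=> [p q pq|]; rewrite mxE.
    rewrite big1 // => s _; have [ps|sp] := ltnP p s; first by rewrite lx ?mul0r.
    by rewrite IH1 ?mulr0 // (leq_ltn_trans sp).
  rewrite (bigD1 i) //= IH2 big1 ?addr0 // => s si.
  have [is_|] := ltnP i s; first by rewrite lx ?mul0r.
  by rewrite leq_eqVlt val_eqE (negPf si) => /= /IH1->; rewrite mulr0.
have [_] := xk n; rewrite xn mxE => /esym/eqP; rewrite expf_eq0 => /andP[_ /eqP].
by [].
Qed.

End Triangular.

(** * Rigidity: gauge transformations between r-matrices are diagonal *)

Section BDLike.

Variables (K : fieldType) (n : nat).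
Implicit Types (x y N : 'M[K]_n) (t : 'M[K]_(n * n)).

(** With [n+], [h], [n-] the upper, diagonal and lower matrices, this says that [t] lies in the sum
    of [n+ (x) n-], [h (x) h] and [n- (x) n+]. *)
Definition opposite_support t := forall i j k l : 'I_n, tcoord t i j k l != 0 ->
  ((i < j)%N = (l < k)%N) /\ ((j < i)%N = (k < l)%N).

(* The features of a Belavin--Drinfeld r-matrix that force the gauge transformations
   between two of them to be diagonal. *)
Definition BD_like t :=
  [/\ opposite_support t, t + tens_flip t = casimir K n
    & exists m, forall x, strictly_lower x -> iter m (contract t) x = 0].

(** The trace form pairs upper with lower matrices, so a tensor with opposite factors contracts to
    an operator respecting the triangular decomposition. *)
Lemma contract_upper_part t x :
  opposite_support t -> contract t (upper_part x) = upper_part (contract t x).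
Proof.
move=> ot; apply/matrixP => i j; rewrite !mxE.
case: ifP => ij; last rewrite big1 //.
  apply: eq_bigr => k _; apply: eq_bigr => l _; rewrite mxE.
  have [->|/ot[<- _]] := eqVneq (tcoord t i j k l) 0; first by rewrite !mul0r.
  by rewrite ij.
move=> k _; rewrite big1 // => l _; rewrite mxE.
have [->|/ot[<- _]] := eqVneq (tcoord t i j k l) 0; first by rewrite !mul0r.
by rewrite ij mulr0.
Qed.

Lemma opposite_support_flip t : opposite_support t -> opposite_support (tens_flip t).
Proof. by move=> ot i j k l; rewrite tcoord_flip => /ot[-> ->]. Qed.

Lemma contract_strictly_upper t x :
  opposite_support t -> strictly_upper x -> strictly_upper (contract t x).
Proof.
move=> ot ux; rewrite -(upper_part_id ux) contract_upper_part //.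
exact: upper_part_strictly_upper.
Qed.

Lemma iter_contract_strictly_upper m t x :
  opposite_support t -> strictly_upper x -> strictly_upper (iter m (contract t) x).
Proof. by move=> ot ux; elim: m => //= m; apply: contract_strictly_upper. Qed.

(** The trace form puts strictly upper and strictly lower matrices in duality, and the adjoint of a
    nilpotent operator is nilpotent. *)
Lemma contract_flip_nilp t : opposite_support t ->
    forall m, (forall x, strictly_lower x -> iter m (contract t) x = 0) ->
  forall x, strictly_upper x -> iter m (contract (tens_flip t)) x = 0.
Proof.
move=> ot m fm x ux; set z := iter _ _ _.
have uz : strictly_upper z.
  by apply: iter_contract_strictly_upper => //; apply: opposite_support_flip.
have adj k y : \tr (iter k (contract (tens_flip t)) x *m y) = \tr (x *m iter k (contract
  t) y).
  elim: k y => // k IHk y; rewrite [in LHS]iterS contract_flip IHk -iterSr //.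
apply/matrixP => i j; rewrite [RHS]mxE; have [ij|/uz //] := ltnP i j.
(* Pairing with [E_ji], which is strictly lower, extracts the entry [z i j]. *)
have := adj m (delta_mx j i); rewrite fm; last first.
  move=> p q pq; rewrite mxE; case: eqP => // pj; case: eqP => // qi.
  by move: pq; rewrite pj qi leqNgt ij.
rewrite mulmx0 mxtrace0 -/z => <-; rewrite /mxtrace (bigD1 i) //= mxE (bigD1 j) //=.
rewrite mxE !eqxx mulr1 !big1 ?addr0 // => [k ki|k kj]; last first.
  by rewrite mxE (negPf kj) mulr0.
by rewrite mxE big1 // => l _; rewrite mxE (negPf ki) andbF mulr0.
Qed.

(* On strictly upper matrices, [contract t] is the identity minus the adjoint of a
   nilpotent map, hence is injective. *)
Lemma BD_like_kernel t m y :
  BD_like t -> iter m (contract t) y = 0 -> upper_part y = 0.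
Proof.
move=> [ot tC [M fM]] fy; have gM := contract_flip_nilp ot fM.
have finj x : strictly_upper x -> contract t x = 0 -> x = 0.
  (* A kernel vector has trace zero, so the Casimir relation makes it a fixed point of the nilpotent
     operator [contract (tens_flip t)]. *)
  move=> ux fx; have gx : contract (tens_flip t) x = x.
    have := contract_casimir x; rewrite -tC contractD fx add0r => ->.
    suff -> : \tr x = 0 by rewrite mul0r -scalemx1 scale0r subr0.
    by rewrite /mxtrace big1 // => i _; rewrite ux.
  rewrite -(gM x ux); elim: M {fM gM} => //= M {1}->.
  suff -> : iter M (contract (tens_flip t)) x = x by rewrite gx.
  by elim: M => //= M ->.
have {fy} : iter m (contract t) (upper_part y) = 0.
  suff -> : iter m (contract t) (upper_part y) = upper_part (iter m (contract t) y).
    by rewrite fy; apply/matrixP => i j; rewrite !mxE if_same.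
  by elim: m {fy} => //= m ->; rewrite contract_upper_part.
elim: m => //= m IHm /finj fm; apply/IHm/fm.
by apply: iter_contract_strictly_upper => //; apply: upper_part_strictly_upper.
Qed.

Definition subdiag_mx : 'M[K]_n := \matrix_(i, j) (i == j.+1 :> nat)%:R.

(** The conjugate [y] of the regular nilpotent is killed by a power of [contract t'], so it has no
    upper part; being nilpotent it is strictly lower. The relation [y *m N = N *m subdiag_mx] then
    determines each column of [N] from the previous one. *)
Lemma Ad2_BD_like_lower t t' N : N \in unitmx -> BD_like t -> BD_like t' ->
  Ad2 N t = t' -> forall i j : 'I_n, (i < j)%N -> N i j = 0.
Proof.
move=> Nu tBD t'BD Nt; pose y := Ad N subdiag_mx.
have lE : strictly_lower subdiag_mx.
  by move=> i j ij; rewrite mxE ltn_eqF // ltnS.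
have yN : y *m N = N *m subdiag_mx by rewrite /y /Ad mulmxKV.
have ly : strictly_lower y.
  apply: nilp_lower_diag0 => [i j ij|].
    have [_ _ [M fM]] := tBD.
    have /(BD_like_kernel t'BD)/matrixP/(_ i j) : iter M (contract t') y = 0.
      suff -> : iter M (contract t') y = Ad N (iter M (contract t) subdiag_mx).
        by rewrite fM // /Ad mulmx0 mul0mx.
      by elim: M {fM} => //= M ->; rewrite -Nt contract_Ad2.
    by rewrite !mxE ij.
  have yk k : y ^+ k *m N = N *m subdiag_mx ^+ k.
    elim: k => [|k IHk]; first by rewrite !expr0 mulmx1 mul1mx.
    rewrite exprSr -[_ * y]/(_ *m y) -mulmxA yN mulmxA IHk -mulmxA.
    by rewrite [in RHS]exprSr.
  by rewrite -[LHS](mulmxK Nu) yk strictly_lower_nilp // mulmx0 mul0mx.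
(* Induction on the column: column [j + 1] of [N] is [y] times column [j], and [y] moves supports
   strictly down. *)
suff H m (i j : 'I_n) : (j <= m)%N -> (i < j)%N -> N i j = 0.
  by move=> i j; apply: (H j).
elim: m i j => [|m IHm] i j jm ij; first by case: (val j) jm ij.
case: j => -[|j] jn //= in jm ij *.
have jn' : (j < n)%N by apply: ltnW.
transitivity ((y *m N) i (Ordinal jn')).
  rewrite yN mxE (bigD1 (Ordinal jn)) //= mxE /= eqxx mulr1 big1 ?addr0 // => p pj.
  by rewrite mxE /= -[p == j.+1 :> nat]/(p == Ordinal jn) (negPf pj) mulr0.
rewrite mxE big1 // => p _; have [ip|pi] := leqP i p; first by rewrite ly ?mul0r.
by rewrite IHm ?mulr0 //= (leq_trans pi).
Qed.

(** The flip passes to the adjoint operator, nilpotent on strictly upper matrices, and transposition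
    brings this back to strictly lower ones. This allows the triangularity argument to be applied to
    [N^T]. *)
Lemma BD_like_opp t : BD_like t -> BD_like (tens_flip t)^T.
Proof.
move=> [ot tC [M fM]]; split.
- by move=> i j k l; rewrite tcoord_tr tcoord_flip => /ot[-> ->].
- have -> : tens_flip (tens_flip t)^T = t^T.
    by apply: tcoordP => *; rewrite !(tcoord_flip, tcoord_tr).
  rewrite addrC -linearD /= tC casimir_swap linearB /= linearZ /= trmx1; congr (_ - _).
  apply: tcoordP => *; rewrite tcoord_tr !tcoord_swap andbC.
  by congr (_ && _)%:R; rewrite eq_sym.
- exists M => x lx; suff -> : iter M (contract (tens_flip t)^T) x =
      (iter M (contract (tens_flip t)) x^T)^T.
    by rewrite (contract_flip_nilp ot fM) ?trmx0 //; apply: strictly_lower_tr.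
  elim: M {fM} => [|M IHM]; first by rewrite trmxK.
  rewrite !iterS IHM; apply/matrixP => i j; rewrite !mxE.
  rewrite exchange_big; apply: eq_bigr => k _; apply: eq_bigr => l _.
  by rewrite tcoord_tr mxE.
Qed.

(** Transposition reverses products, so [t] and [t'] exchange their roles. *)
Lemma Ad2_opp t t' N : N \in unitmx -> Ad2 N t = t' ->
  Ad2 N^T (tens_flip t')^T = (tens_flip t)^T.
Proof.
move=> Nu <-; rewrite Ad2_flip !Ad2E !trmx_mul !trmx_tens -trmx_inv.
have V1 : N^T *m (invmx N)^T = 1%:M by rewrite -trmx_mul mulVmx // trmx1.
rewrite !mulmxA tensmx_mul V1 tensmx11 mul1mx -mulmxA tensmx_mul V1 tensmx11.
by rewrite mulmx1.
Qed.

Lemma Ad2_BD_like_diag t t' N : N \in unitmx -> BD_like t -> BD_like t' ->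
  Ad2 N t = t' -> forall i j : 'I_n, i != j -> N i j = 0.
Proof.
move=> Nu tBD t'BD Nt i j; rewrite -val_eqE neq_ltn => /orP[].
  exact: Ad2_BD_like_lower tBD t'BD Nt _ _.
move=> ji; have := Ad2_BD_like_lower _ (BD_like_opp t'BD) (BD_like_opp tBD) (Ad2_opp Nu
  Nt) ji.
by rewrite mxE => -> //; rewrite unitmx_tr.
Qed.

Lemma diag_unitmx_neq0 N i :
  N \in unitmx -> (forall i j, i != j -> N i j = 0) -> N i i != 0.
Proof.
move=> Nu Nd; apply/eqP => Ni0; have /matrixP/(_ i i) := mulmxV Nu.
rewrite !mxE eqxx big1 => [/eqP|j _]; first by rewrite eq_sym oner_eq0.
by have [<-|/Nd->] := eqVneq i j; rewrite ?Ni0 mul0r.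
Qed.

(** Compare coordinates in [(N *t N) *m t = t' *m (N *t N)]. Free of denominators, this shows that
    zero coordinates stay zero and that those on [E_ii (x) E_kk] do not change. *)
Lemma tcoord_Ad2_diag N t t' i j k l :
    N \in unitmx -> (forall i j, i != j -> N i j = 0) -> Ad2 N t = t' ->
  N i i * N k k * tcoord t i j k l = tcoord t' i j k l * (N j j * N l l).
Proof.
move=> Nu Nd Nt; have : (N *t N) *m t = t' *m (N *t N).
  by rewrite -Nt Ad2E -(mulmxA _ (invmx N *t invmx N)) tensmx_mul mulVmx // tensmx11 mulmx1.
move/(congr1 (fun u => tcoord u i j k l)); rewrite !tcoord_mul.
rewrite (bigD1 i) //= (bigD1 k) //= [RHS](bigD1 j) //= [X in _ = X + _](bigD1 l) //=.
rewrite !tcoord_tens !big1 ?addr0 // => [p pj|q ql|p pi|q qk].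
- by rewrite big1 // => q _; rewrite tcoord_tens (Nd p j) ?mul0r ?mulr0.
- by rewrite tcoord_tens (Nd q l) ?mulr0.
- by rewrite big1 // => q _; rewrite tcoord_tens (Nd i p) ?mul0r // eq_sym.
- by rewrite tcoord_tens (Nd k q) ?mulr0 ?mul0r // eq_sym.
Qed.

End BDLike.

(** * Positive roots as sums of consecutive simple roots *)

Section RootVectors.

Variables (K : fieldType) (n : nat).
Local Notation B := (simple_roots K n).
Local Notation alpha := (@simple_root K n).

Lemma root_vecD (i j k : 'I_n) : root_vec K i j + root_vec K j k = root_vec K i k.
Proof. by rewrite /root_vec addrA subrK. Qed.

Lemma ord_hi_inj : injective (@ord_hi n).
Proof. by move=> i j /(congr1 val)/= /succn_inj /val_inj. Qed.

Lemma ord_lo_inj : injective (@ord_lo n).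
Proof. by move=> i j /(congr1 val)/= /val_inj. Qed.

Lemma ord_lo_hi (m : 'I_n.-1) : (ord_lo m < ord_hi m)%N.
Proof. by []. Qed.

Lemma ord_hiP (i j : 'I_n) : (i < j)%N -> exists m : 'I_n.-1, j = ord_hi m.
Proof.
move=> ij; have jm : (j.-1 < n.-1)%N.
  by rewrite -ltnS !prednK // (leq_ltn_trans _ ij, leq_ltn_trans _ (ltn_ord i)).
exists (Ordinal jm); apply: val_inj; rewrite /= prednK //.
exact: leq_ltn_trans ij.
Qed.

(** Induction on height with the left end fixed: a positive root that is not simple arises from a
    shorter one by adding a simple root at its right end. *)
Lemma root_vec_ind (P : 'I_n -> 'I_n -> Prop) :
    (forall m, P (ord_lo m) (ord_hi m)) ->
    (forall (i : 'I_n) (m : 'I_n.-1), (i < ord_lo m)%N -> P i (ord_lo m) -> P i (ord_hi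
      m)) ->
  forall i j : 'I_n, (i < j)%N -> P i j.
Proof.
move=> P1 P2 i j; have [k] := ubnP (val j); elim: k j => // k IHk j jk ij.
have [m jE] := ord_hiP ij; rewrite jE; have : (i <= ord_lo m)%N by rewrite -ltnS jE in ij *.
rewrite leq_eqVlt => /orP[/eqP/val_inj-> //|im]; apply: P2 => //.
by apply: IHk => //; rewrite jE in jk.
Qed.

Lemma coord_root_vec (i j : 'I_n) (m : 'I_n.-1) :
  (i < j)%N -> coord B m (root_vec K i j) = (i <= m < j)%N%:R.
Proof.
move: i j; apply: root_vec_ind => [p|i p ip IH].
  rewrite -/(alpha p) coord_simple_root /= ltnS -eqn_leq; congr _%:R.
rewrite -(root_vecD i (ord_lo p)) linearD /= IH -/(alpha p) coord_simple_root.
rewrite -natrD /=; congr _%:R; rewrite ltnS -val_eqE /=.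
by case: ltngtP => mp; rewrite ?andbT ?andbF ?addn0 //= mp [(i <= p)%N]ltnW.
Qed.

End RootVectors.

(** * The isomorphism [theta] on root vectors *)

Section Theta.

Variables (K : fieldType) (n : nat) (T : BD_triple n).
Variable theta : 'M[K]_n -> 'M[K]_n.
Hypothesis thetaT : is_theta T theta.

Local Notation G1 := (BD_G1 T).
Local Notation G2 := (BD_G2 T).
Local Notation tau := (BD_tau T).
Local Notation alpha := (@simple_root K n).
Local Notation B := (simple_roots K n).
Local Notation root := (root_vec K).
Local Notation span1 := (span_G1 K T).
Local Notation E i j := (delta_mx i j : 'M[K]_n).

Lemma mem_root_span (i j : 'I_n) (m : 'I_n.-1) :
  (i < j)%N -> root i j \in span1 -> (i <= m < j)%N -> m \in G1.
Proof.
move=> ij ijG imj; apply: coord_span_G1 ijG _.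
by rewrite coord_root_vec // imj oner_eq0.
Qed.

Lemma simple_root_span m : m \in G1 -> alpha m \in span1.
Proof. by move=> mG; apply/memv_span/imageP; exists m. Qed.

Lemma root_spanP (i j : 'I_n) : (i < j)%N ->
  reflect (forall m : 'I_n.-1, (i <= m < j)%N -> m \in G1) (root i j \in span1).
Proof.
move=> ij; apply: (iffP idP) => [ijG m|]; first exact: mem_root_span.
move: i j ij; apply: root_vec_ind => [m|i m im IH] H.
  by apply: simple_root_span; apply: H; rewrite /= leqnn ltnS leqnn.
rewrite -(root_vecD K i (ord_lo m)) memvD //.
  by apply: IH => p /andP[ip pm]; apply: H; rewrite ip ltnW.
by apply: simple_root_span; apply: H; rewrite /= ltnS leqnn (ltnW im).
Qed.

Lemma tau_extD v w : tau_ext T (v + w) = tau_ext T v + tau_ext T w :> 'rV[K]_n.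
Proof.
rewrite /tau_ext -big_split /=; apply: eq_bigr => m _.
by rewrite -scalerDl -linearD.
Qed.

Lemma tau_ext_simple m : m \in G1 -> tau_ext T (alpha m) = alpha (tau m).
Proof.
move=> mG; rewrite /tau_ext (bigD1 m) //= coord_simple_root eqxx scale1r.
rewrite big1 ?addr0 // => p /andP[_ pm].
by rewrite coord_simple_root eq_sym (negPf pm) scale0r.
Qed.

Lemma delta_mx_neq0 (i j : 'I_n) : E i j != 0.
Proof. by apply/eqP => /matrixP/(_ i j); rewrite !mxE !eqxx; apply/eqP/oner_neq0. Qed.

Lemma theta0 : theta 0 = 0.
Proof.
have [_ lin _ _ _] := thetaT; have := lin 1 0 0 (LieGen0 _ _) (LieGen0 _ _).
by rewrite !scale1r addr0 => /(congr1 (fun x => x - theta 0)); rewrite subrr addrK.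
Qed.

Lemma thetaZ c a : lie_gen G1 a -> theta (c *: a) = c *: theta a.
Proof.
have [_ lin _ _ _] := thetaT => aG.
by have := lin c a 0 aG (LieGen0 _ _); rewrite !addr0 theta0 addr0.
Qed.

Lemma lie_br_delta_neg (m : 'I_n.-1) (i : 'I_n) : (i < ord_lo m)%N ->
  lie_br (e_neg K m) (E (ord_lo m) i) = E (ord_hi m) i.
Proof.
move=> im; rewrite /lie_br !mul_delta_mx_cond eqxx mulr1n -val_eqE ltn_eqF ?subr0 //.
exact: ltn_trans im (ord_lo_hi m).
Qed.

(* [theta] preserves brackets and is injective, so the bracket of the images of two
   lower root vectors is a nonzero multiple of a root vector. *)
Lemma theta_root_vector (i j : 'I_n) : (i < j)%N -> root i j \in span1 ->
  lie_gen G1 (E j i) /\ exists i' j' : 'I_n, exists eps : K,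
    [/\ (i' < j')%N, theta (E j i) = eps *: E j' i' & root i' j' = tau_ext T (root i j)].
Proof.
have [thetaE _ thetaBr theta_inj _] := thetaT.
move: i j; apply: root_vec_ind => [m|i m im IH] ijG.
  have mG : m \in G1 by apply: mem_root_span ijG _; rewrite //= leqnn ltnS leqnn.
  split; first exact: LieGenNeg.
  exists (ord_lo (tau m)), (ord_hi (tau m)), 1; split=> //; last first.
    by rewrite -/(alpha m) -/(alpha (tau m)) tau_ext_simple.
  by rewrite scale1r; have [_] := thetaE m mG.
have [|gE [i' [j' [eps [ij' thE rE]]]]] := IH.
  apply/root_spanP => // p /andP[ip pm]; apply: mem_root_span ijG _.
    exact: ltn_trans im (ord_lo_hi m).
  by rewrite ip ltnW.
have mG : m \in G1.
  apply: mem_root_span ijG _; first exact: ltn_trans im (ord_lo_hi m).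
  by rewrite (ltnW im) /= ltnS leqnn.
have gm := LieGenNeg K mG.
have gEE : lie_gen G1 (E (ord_hi m) i).
  by rewrite -lie_br_delta_neg //; apply: LieGenBr.
split=> //.
have rS : tau_ext T (root i (ord_hi m)) = root i' j' + alpha (tau m).
  by rewrite -(root_vecD K i (ord_lo m)) tau_extD rE -/(alpha m) tau_ext_simple.
have thS : theta (E (ord_hi m) i) = eps *:
    (E (ord_hi (tau m)) i' *+ (ord_lo (tau m) == j') - E j' (ord_lo (tau m)) *+ (i' ==
      ord_hi (tau m))).
  rewrite -lie_br_delta_neg // thetaBr // thE; have [_ ->] := thetaE m mG.
  by rewrite /lie_br -scalemxAr -scalemxAl -scalerBr !mul_delta_mx_cond.
(* The new simple root extends the image root at its right end, or at its left end with a change of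
   sign. Otherwise the bracket is zero, against injectivity of [theta]. *)
move: thS rS; have [j'E|_] := eqVneq (ord_lo (tau m)) j'.
  have -> : (i' == ord_hi (tau m)) = false.
    by rewrite -val_eqE ltn_eqF // (ltn_trans ij') // -j'E.
  rewrite subr0 => thS rS; exists i', (ord_hi (tau m)), eps; split=> //.
    by rewrite (ltn_trans ij') // -j'E.
  by rewrite rS -j'E root_vecD.
have [i'E|_] := eqVneq i' (ord_hi (tau m)).
  rewrite mulr0n add0r scalerN -scaleNr => thS rS.
  exists (ord_lo (tau m)), j', (- eps); split=> //.
    by rewrite (ltn_trans _ ij') // i'E.
  by rewrite rS i'E addrC root_vecD.
rewrite subrr scaler0 -theta0 => /(theta_inj _ _ gEE (LieGen0 _ _))/eqP.
by rewrite (negPf (delta_mx_neq0 _ _)).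
Qed.

Lemma tau_definedS k (v : 'rV[K]_n) :
  tau_defined T k.+1 v = tau_defined T k v && (iter k (tau_ext T) v \in span1).
Proof.
apply/forallP/andP => [H|[/forallP H1 H2] j].
  split; last exact: (H ord_max).
  by apply/forallP => j; apply: (H (widen_ord (leqnSn k) j)).
have := ltn_ord j; rewrite ltnS leq_eqVlt => /orP[/eqP-> //|jk].
exact: (H1 (Ordinal jk)).
Qed.

Lemma tau_definedD k m (v : 'rV[K]_n) :
  tau_defined T (k + m) v = tau_defined T k v && tau_defined T m (iter k (tau_ext T) v).
Proof.
elim: m => [|m IHm].
  by rewrite addn0 (_ : tau_defined T 0 _) ?andbT //; apply/forallP => -[].
by rewrite addnS !tau_definedS IHm -andbA -iterD addnC.
Qed.

Lemma tau_defined_leq k m (v : 'rV[K]_n) :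
  (k <= m)%N -> tau_defined T m v -> tau_defined T k v.
Proof. by move=> /subnKC<-; rewrite tau_definedD => /andP[]. Qed.

(** This places the two factors of every wedge term of [r1] in opposite triangular parts and
    identifies the root that results. *)
Lemma iter_theta_root_vector k (i j : 'I_n) :
    (i < j)%N -> tau_defined T k (root i j) ->
  exists i' j' : 'I_n, exists eps : K,
    [/\ (i' < j')%N, iter k theta (E j i) = eps *: E j' i'
      & root i' j' = iter k (tau_ext T) (root i j)].
Proof.
move=> ij; elim: k => [_|k IHk].
  by exists i, j, 1; rewrite scale1r.
rewrite tau_definedS => /andP[/IHk[i1 [j1 [e1 [ij1 E1 R1]]]] kG].
rewrite -R1 in kG; have [g1 [i2 [j2 [e2 [ij2 E2 R2]]]]] := theta_root_vector ij1 kG.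
exists i2, j2, (e1 * e2); split=> //; first by rewrite iterS E1 thetaZ // E2 scalerA.
by rewrite R2 R1.
Qed.

End Theta.

(** * Belavin--Drinfeld r-matrices have the rigidity features *)

Section RMatrix.

Variables (K : fieldType) (n : nat) (T : BD_triple n).
Variable theta : 'M[K]_n -> 'M[K]_n.
Hypotheses (admT : admissible K T) (thetaT : is_theta T theta).
Variable r0 : 'M[K]_(n * n).
Hypothesis r0_cartan : tens_sub (@cartan K n) r0.
Hypothesis r0_flip : r0 + tens_flip r0 = casimir0 K n.

Local Notation E i j := (delta_mx i j : 'M[K]_n).
Local Notation root := (root_vec K).
Local Notation r1 := (BD_r1 T theta).

Lemma tcoord_cartan (i j k l : 'I_n) :
  tcoord r0 i j k l != 0 -> i = j /\ k = l.
Proof.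
suff H : (i == j) && (k == l) || (tcoord r0 i j k l == 0).
  by move=> /negPf r0n; move: H; rewrite r0n orbF => /andP[/eqP-> /eqP->].
elim/tens_sub_ind: r0_cartan => [|t u /orP[->//|t0] /orP[->//|u0]|a b [/is_diag_mxP da _]
  [/is_diag_mxP db _]].
- by rewrite tcoord0 eqxx orbT.
- by rewrite tcoordD (eqP t0) (eqP u0) addr0 eqxx orbT.
- rewrite tcoord_tens; have [->|ij] := eqVneq i j; last by rewrite (da i j) // mul0r eqxx.
  by have [->|kl] := eqVneq k l => //; rewrite (db k l) // mulr0 eqxx.
Qed.

Lemma tens_sub_sl_r : tens_sub sl (r0 + r1).
Proof.
have slE (i j : 'I_n) : i != j -> sl (E i j).
  move=> ij; rewrite /sl /mxtrace big1 // => k _; rewrite mxE.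
  by case: eqP => // ->; rewrite (negPf ij).
apply: tens_subD; first by apply: tens_subS r0_cartan => a [].
apply: tens_subD; apply: tens_sub_sum => i _; apply: tens_sub_sum => j.
  by move=> ij; apply: tens_sub_tens; apply: slE;
    rewrite -val_eqE /= ?(ltn_eqF ij) ?(gtn_eqF ij).
move=> /andP[ij _]; apply: tens_sub_sum => k kd.
have [i' [j' [eps [ij' -> _]]]] := iter_theta_root_vector thetaT ij kd.
rewrite /tens_wedge -tensmxNl.
have sl1 : sl (E i j) by apply: slE; rewrite -val_eqE ltn_eqF.
have sl2 : sl (eps *: E j' i').
  by rewrite /sl linearZ /= slE ?mulr0 // -val_eqE gtn_eqF.
apply: tens_subD; apply: tens_sub_tens => //.
by rewrite /sl linearN /= sl2 oppr0.
Qed.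

Lemma tens_flip_wedge (a b : 'M[K]_n) : tens_flip (tens_wedge a b) = - tens_wedge a b.
Proof. by rewrite /tens_wedge tens_flipB !tens_flip_tens opprB. Qed.

Lemma tens_flip_sum I (s : seq I) (P : pred I) (F : I -> 'M[K]_(n * n)) :
  tens_flip (\sum_(i <- s | P i) F i) = \sum_(i <- s | P i) tens_flip (F i).
Proof.
elim/big_rec2: _ => [|i y t _ <-]; last by rewrite tens_flipD.
by apply: tcoordP => *; rewrite tcoord_flip !tcoord0.
Qed.

Lemma tcoord_diag_part (t : 'M[K]_(n * n)) (i j k l : 'I_n) :
  tcoord (tens_map (@diag_part K n) (@diag_part K n) t) i j k l =
  ((i == j) && (k == l))%:R * tcoord t i j k l.
Proof.
rewrite [in RHS](tens_expand t) /tens_map /tens_lift !tcoord_sum mulr_sumr.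
apply: eq_bigr => i' _; rewrite !tcoord_sum mulr_sumr; apply: eq_bigr => j' _.
rewrite !tcoord_sum mulr_sumr; apply: eq_bigr => k' _.
rewrite !tcoord_sum mulr_sumr; apply: eq_bigr => l' _.
rewrite !tcoordZ mulrCA; congr (_ * _);
  rewrite !tcoord_tens /diag_part ![diag_mx _ _ _]mxE ![(\row__ _) _ _]mxE.
by have [->|] := eqVneq i j; have [->|] := eqVneq k l;
  rewrite ?mulr1n ?mulr0n ?mul1r ?mul0r ?mulr0.
Qed.

Lemma tcoord_casimir (i j k l : 'I_n) : tcoord (casimir K n) i j k l =
  ((i == l) && (k == j))%:R - n%:R^-1 * ((i == j) && (k == l))%:R.
Proof.
rewrite casimir_swap tcoordB tcoord_swap tcoordZ -tensmx11 tcoord_tens !mxE.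
by rewrite -natrM mulnb.
Qed.

(** The wedge terms are antisymmetric and cancel, the standard part and its flip give all
    [E_ij (x) E_ji] with [i] and [j] distinct, and [r0] supplies the Cartan component. *)
Lemma r_flip : (r0 + r1) + tens_flip (r0 + r1) = casimir K n.
Proof.
rewrite tens_flipD addrACA r0_flip /BD_r1; set st := \sum_(i < n) _;
  set w := \sum_(i < n) _.
have -> : tens_flip (st + w) = tens_flip st - w.
  rewrite tens_flipD; congr (_ + _); rewrite /w tens_flip_sum -sumrN; apply: eq_bigr => i _.
  rewrite tens_flip_sum -sumrN; apply: eq_bigr => j _.
  rewrite tens_flip_sum -sumrN; apply: eq_bigr => k _; exact: tens_flip_wedge.
rewrite addrACA subrr addr0.
have stE (i j k l : 'I_n) : tcoord st i j k l = ((i == l) && (k == j))%:R * (i < j)%N%:R.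
  rewrite /st tcoord_sum (bigD1 i) //= tcoord_sum [X in _ + X]big1 => [|p pi]; last first.
    by rewrite tcoord_sum big1 // => q _; rewrite tcoord_tens mxE eq_sym (negPf pi) mul0r.
  rewrite addr0; case: (ltnP i j) => ij; last first.
    rewrite mulr0 big1 // => q iq; rewrite tcoord_tens !mxE eqxx /=.
    by case: eqP => [jq|]; rewrite ?mul0r //; move: iq; rewrite -jq ltnNge ij.
  rewrite (bigD1 j) //= tcoord_tens !mxE !eqxx mul1r mulr1 big1 ?addr0 => [|q /andP[_ qj]].
    by rewrite andbC [l == i]eq_sym.
  by rewrite tcoord_tens !mxE [j == q]eq_sym (negPf qj) andbF mul0r.
apply: tcoordP => i j k l; rewrite [RHS]tcoord_casimir !tcoordD tcoord_flip !stE.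
rewrite tcoord_diag_part tcoord_casimir.
rewrite [(k == j) && (i == l)]andbC -mulrDr.
have [->|il] := eqVneq i l; have [->|kj] := eqVneq k j => /=;
  rewrite ?mul0r ?mul1r ?addr0 ?sub0r.
- have [->|lj] := eqVneq l j; first by rewrite ltnn /= !mul1r !addr0.
  rewrite /= mul0r mulr0 add0r subr0 -natrD.
  by move: lj; rewrite -val_eqE neq_ltn => /orP[] lj; rewrite lj ltnNge (ltnW lj).
- by case: (_ && _); rewrite ?mul1r ?mul0r ?mulr0 ?oppr0.
- by case: (_ && _); rewrite ?mul1r ?mul0r ?mulr0 ?oppr0.
- by case: (_ && _); rewrite ?mul1r ?mul0r ?mulr0 ?oppr0.
Qed.

Lemma opposite_supportD (t u : 'M[K]_(n * n)) :
  opposite_support t -> opposite_support u -> opposite_support (t + u).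
Proof.
move=> ot ou i j k l; rewrite tcoordD.
have [->|/ot //] := eqVneq (tcoord t i j k l) 0; rewrite add0r; exact: ou.
Qed.

Lemma opposite_support_sum I (s : seq I) (P : pred I) (F : I -> 'M[K]_(n * n)) :
  (forall i, P i -> opposite_support (F i)) ->
  opposite_support (\sum_(i <- s | P i) F i).
Proof.
move=> oF; elim/big_ind: _ => // [i j k l|]; last exact: opposite_supportD.
by rewrite tcoord0 eqxx.
Qed.

Lemma opposite_support_tens (c : K) (i j i' j' : 'I_n) :
  (i < j)%N -> (i' < j')%N -> opposite_support (E i j *t (c *: E j' i')).
Proof.
move=> ij ij' p q k l; rewrite tcoord_tens !mxE.
have [->|_] := eqVneq p i; last by rewrite mul0r eqxx.
have [->|_] := eqVneq q j; last by rewrite mul0r eqxx.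
have [->|_] := eqVneq k j'; last by rewrite !mulr0 eqxx.
have [->|_] := eqVneq l i'; last by rewrite !mulr0 eqxx.
by rewrite ij ij' ![(_ < _)%N]ltnNge (ltnW ij) (ltnW ij').
Qed.

Lemma opposite_support_r : opposite_support (r0 + r1).
Proof.
apply: opposite_supportD.
  by move=> i j k l /tcoord_cartan[-> ->]; rewrite !ltnn.
apply: opposite_supportD; apply: opposite_support_sum => i _;
  apply: opposite_support_sum => j.
  by move=> ij; rewrite -[E j i]scale1r; apply: opposite_support_tens.
move=> /andP[ij _]; apply: opposite_support_sum => k kd.
have [i' [j' [eps [ij' -> _]]]] := iter_theta_root_vector thetaT ij kd.
rewrite /tens_wedge -tensmxNr; apply: opposite_supportD; rewrite -?scaleNr.
  exact: opposite_support_tens.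
have -> : (eps *: E j' i') *t - E i j = tens_flip (E i j *t ((- eps) *: E j' i')).
  by rewrite tens_flip_tens tensmxZl tensmxZl tensmxNr scalerN scaleNr.
exact/opposite_support_flip/opposite_support_tens.
Qed.

Lemma trace_delta_mul (i j k l : 'I_n) :
  \tr (E i j *m E k l) = ((i == l) && (j == k))%:R :> K.
Proof.
rewrite mul_delta_mx_cond; have [_|_] := eqVneq j k; last by rewrite mxtrace0 andbF.
rewrite mulr1n andbT /mxtrace (bigD1 i) //= mxE eqxx /= big1 ?addr0 // => p pi.
by rewrite mxE (negPf pi).
Qed.

(** The form dual to [E_ji] detects only [E_ij] in the second factor, and this occurs only in the
    subtracted halves of the wedges belonging to the root of [E_ij]. *)
Lemma contract_r_lower (i j : 'I_n) : (i < j)%N ->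
  contract (r0 + r1) (E j i) =
  - \sum_(1 <= k < n | (root i j \in span_G1 K T) && tau_defined T k (root i j)) iter k
    theta (E j i).
Proof.
move=> ij; have low0 (p q p' q' : 'I_n) : (p < q)%N -> (p' < q')%N ->
    \tr (E q p *m E q' p') = 0 :> K.
  move=> pq pq'; rewrite trace_delta_mul; have [qp|//] := eqVneq q p';
    have [pq2|//] := eqVneq p q'.
  by move: pq; rewrite qp pq2 ltnNge (ltnW pq').
have c0 : contract r0 (E j i) = 0.
  apply/matrixP => p q; rewrite !mxE big1 // => k _; rewrite big1 // => l _.
  have [->|/tcoord_cartan[_ ->]] := eqVneq (tcoord r0 p q k l) 0; first by rewrite mul0r.
  rewrite mxE; have [->|_] := eqVneq l j; last by rewrite mulr0.
  by rewrite -val_eqE gtn_eqF // mulr0.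
rewrite contractD c0 add0r contractD contract_sum big1 ?add0r; last first.
  move=> p _; rewrite contract_sum big1 // => q pq.
  by rewrite contract_tens low0 // scale0r.
have wedgeE (p q : 'I_n) k : (p < q)%N -> tau_defined T k (root p q) ->
    contract (tens_wedge (E p q) (iter k theta (E q p))) (E j i) =
    - (((p == i) && (q == j))%:R *: iter k theta (E q p)).
  move=> pq kd; have [i' [j' [eps [ij' -> _]]]] := iter_theta_root_vector thetaT pq kd.
  rewrite /tens_wedge contractD contract_tens -scalemxAl linearZ /= low0 // mulr0 scale0r
    add0r.
  by rewrite -scaleN1r contractZ contract_tens trace_delta_mul scaleN1r.
rewrite contract_sum (bigD1 i) //= [X in _ + X]big1 ?addr0; last first.
  move=> p pi; rewrite contract_sum big1 // => q /andP[pq _].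
  rewrite contract_sum big1 // => k kd; rewrite wedgeE //.
  by rewrite (negPf pi) scale0r oppr0.
rewrite contract_sum; have [rG|rG] := boolP (root i j \in _); last first.
  rewrite big1 => [|q /andP[iq qG]].
    by rewrite big_pred0_eq oppr0.
  rewrite contract_sum big1 // => k kd; rewrite wedgeE //.
  have [qj|_] := eqVneq q j; last by rewrite andbF scale0r oppr0.
  by rewrite qj (negPf rG) in qG.
rewrite (bigD1 j) ?ij //= [X in _ + X]big1 ?addr0; last first.
  move=> q /andP[/andP[iq _] qj]; rewrite contract_sum big1 // => k kd.
  by rewrite wedgeE // (negPf qj) andbF scale0r oppr0.
rewrite contract_sum -sumrN; apply: eq_bigr => k kd.
by rewrite wedgeE // !eqxx scale1r.
Qed.

Lemma iter_contract_sum (t : 'M[K]_(n * n)) m I (s : seq I) (P : pred I) (F : I ->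
  'M[K]_n) :
  iter m (contract t) (\sum_(i <- s | P i) F i) =
  \sum_(i <- s | P i) iter m (contract t) (F i).
Proof. by elim: m => //= m ->; rewrite linear_sum. Qed.

Lemma iter_contractZ (t : 'M[K]_(n * n)) m (c : K) (x : 'M[K]_n) :
  iter m (contract t) (c *: x) = c *: iter m (contract t) x.
Proof. by elim: m => //= m ->; rewrite linearZ. Qed.

(** Each contraction applies [theta] at least once, so it uses up one of the possible applications
    of [tau], of which there are fewer than [n]. *)
Lemma contract_r_nilp (x : 'M[K]_n) :
  strictly_lower x -> iter n (contract (r0 + r1)) x = 0.
Proof.
(* The induction tracks the root: [m] contractions kill its lower root vector as soon as the [m]-th
   power of [tau] is undefined on it. *)
suff H m : forall i j : 'I_n, (i < j)%N -> ~~ tau_defined T m (root i j) ->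
    iter m (contract (r0 + r1)) (E j i) = 0.
  move=> lx; rewrite [x]matrix_sum_delta iter_contract_sum big1 // => j _.
  rewrite iter_contract_sum big1 // => i _; rewrite iter_contractZ.
  have [/lx->|ij] := leqP j i; first by rewrite scale0r.
  rewrite H ?scaler0 //; apply/negP => /(tau_defined_ltn admT ij).
  by rewrite ltnn.
elim: m => [|m IHm] i j ij ndef.
  by case/negP: ndef; apply/forallP => -[].
rewrite iterSr contract_r_lower // -sumrN iter_contract_sum.
rewrite big_seq_cond big1 // => k; rewrite mem_index_iota => /andP[/andP[k0 _] /andP[_ kd]].
have [i' [j' [eps [ij' E1 R1]]]] := iter_theta_root_vector thetaT ij kd.
rewrite E1 -scaleNr iter_contractZ IHm ?scaler0 // R1.
apply: contra ndef => md; apply: (@tau_defined_leq _ _ _ _ (k + m)).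
  by rewrite -add1n leq_add2r.
by rewrite tau_definedD kd.
Qed.

Lemma BD_like_r : BD_like (r0 + r1).
Proof.
split; [exact: opposite_support_r|exact: r_flip|].
by exists n; apply: contract_r_nilp.
Qed.

End RMatrix.

(** * Reflection: conjugate transpose followed by conjugation by [S] *)

Section Reflection.

Variables (K : fieldType) (bar : {rmorphism K -> K}) (n : nat).
Hypothesis barK : involutive bar.
Implicit Types (a b x : 'M[K]_n) (t : 'M[K]_(n * n)).
Local Notation S := (antidiag_mx K n).

Lemma antidiagK : S *m S = 1%:M.
Proof.
apply/matrixP => i j; rewrite !mxE (bigD1 (rev_ord i)) //= !mxE rev_ordK eqxx mul1r.
rewrite big1 ?addr0 => [|p pi]; first by rewrite (inj_eq rev_ord_inj).
by rewrite mxE -(inj_eq rev_ord_inj) rev_ordK eq_sym (negPf pi) mul0r.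
Qed.

Lemma antidiag_unit : S \in unitmx.
Proof. by case: (mulmx1_unit antidiagK). Qed.

Lemma invmx_antidiag : invmx S = S.
Proof. by rewrite -[RHS](mulKmx antidiag_unit) antidiagK mulmx1. Qed.

Lemma Ad_antidiag a i j : Ad S a i j = a (rev_ord i) (rev_ord j).
Proof.
rewrite /Ad invmx_antidiag mxE (bigD1 (rev_ord j)) //= !mxE eqxx mulr1.
rewrite [X in _ + X]big1 ?addr0 => [|p pj]; last first.
  by rewrite [S _ _]mxE (negPf pj) mulr0.
rewrite (bigD1 (rev_ord i)) //= big1 => [|p pi].
  by rewrite !mxE rev_ordK eqxx mul1r addr0.
by rewrite !mxE -(inj_eq rev_ord_inj) rev_ordK eq_sym (negPf pi) mul0r.
Qed.

Lemma tcoord_Ad2_antidiag t i j k l :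
  tcoord (Ad2 S t) i j k l = tcoord t (rev_ord i) (rev_ord j) (rev_ord k) (rev_ord l).
Proof.
rewrite [in RHS](tens_expand t) /Ad2 /tens_map /tens_lift !tcoord_sum.
apply: eq_bigr => i' _; rewrite !tcoord_sum; apply: eq_bigr => j' _.
rewrite !tcoord_sum; apply: eq_bigr => k' _.
rewrite !tcoord_sum; apply: eq_bigr => l' _.
by rewrite !tcoordZ !tcoord_tens !Ad_antidiag.
Qed.

(** This is [S a^* S], a semilinear antiautomorphism. It preserves upper and lower triangular
    matrices and acts on simple root vectors by [s]. *)
Definition reflect_mx a : 'M[K]_n := \matrix_(i, j) bar (a (rev_ord j) (rev_ord i)).

Definition reflect_tens t := Ad2 S (conjtr bar t).

Lemma tcoord_reflect t i j k l : tcoord (reflect_tens t) i j k l =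
  bar (tcoord t (rev_ord j) (rev_ord i) (rev_ord l) (rev_ord k)).
Proof. by rewrite tcoord_Ad2_antidiag tcoord_conjtr. Qed.

Lemma reflect_mxK : involutive reflect_mx.
Proof. by move=> a; apply/matrixP => i j; rewrite !mxE barK !rev_ordK. Qed.

Lemma reflect_mxD a b : reflect_mx (a + b) = reflect_mx a + reflect_mx b.
Proof. by apply/matrixP => i j; rewrite !mxE rmorphD. Qed.

Lemma reflect_mxZ c a : reflect_mx (c *: a) = bar c *: reflect_mx a.
Proof. by apply/matrixP => i j; rewrite !mxE rmorphM. Qed.

Lemma reflect_mx0 : reflect_mx 0 = 0.
Proof. by apply/matrixP => i j; rewrite !mxE rmorph0. Qed.

Lemma reflect_mxM a b : reflect_mx (a *m b) = reflect_mx b *m reflect_mx a.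
Proof.
apply/matrixP => i j; rewrite !mxE rmorph_sum (reindex_inj rev_ord_inj) /=.
by apply: eq_bigr => p _; rewrite !mxE rmorphM mulrC.
Qed.

Lemma reflect_mx_br a b :
  reflect_mx (lie_br a b) = lie_br (reflect_mx b) (reflect_mx a).
Proof.
rewrite /lie_br -!reflect_mxM -scaleN1r reflect_mxD reflect_mxZ.
by rewrite rmorphN rmorph1 scaleN1r.
Qed.

Lemma reflect_mx_delta i j : reflect_mx (delta_mx i j) = delta_mx (rev_ord j) (rev_ord i).
Proof.
apply/matrixP => p q; rewrite !mxE rmorph_nat andbC.
by rewrite -(inj_eq rev_ord_inj) rev_ordK -[rev_ord q == _](inj_eq rev_ord_inj) rev_ordK.
Qed.

Lemma reflect_tens_tens a b : reflect_tens (a *t b) = reflect_mx a *t reflect_mx b.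
Proof.
by apply: tcoordP => *; rewrite tcoord_reflect !tcoord_tens !mxE rmorphM.
Qed.

Lemma reflect_tensD t u : reflect_tens (t + u) = reflect_tens t + reflect_tens u.
Proof. by apply: tcoordP => *; rewrite !(tcoord_reflect, tcoordD) rmorphD. Qed.

Lemma reflect_tensB t u : reflect_tens (t - u) = reflect_tens t - reflect_tens u.
Proof. by apply: tcoordP => *; rewrite !(tcoord_reflect, tcoordB) rmorphB. Qed.

Lemma reflect_tens_sum I (s : seq I) (P : pred I) (F : I -> 'M[K]_(n * n)) :
  reflect_tens (\sum_(i <- s | P i) F i) = \sum_(i <- s | P i) reflect_tens (F i).
Proof.
elim/big_rec2: _ => [|i y t _ <-]; last by rewrite reflect_tensD.
by apply: tcoordP => *; rewrite tcoord_reflect !tcoord0 rmorph0.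
Qed.

Lemma contract_reflect t x :
  contract (reflect_tens t) (reflect_mx x) = reflect_mx (contract t x).
Proof.
apply/matrixP => i j;
  rewrite !mxE rmorph_sum [RHS](reindex_inj rev_ord_inj) exchange_big /=.
apply: eq_bigr => k _; rewrite rmorph_sum [RHS](reindex_inj rev_ord_inj) /=.
by apply: eq_bigr => l _; rewrite tcoord_reflect rmorphM mxE.
Qed.

Lemma rev_ord_ltn m (i j : 'I_m) : (rev_ord i < rev_ord j)%N = (j < i)%N.
Proof. by rewrite /= ltn_sub2lE // ltnS. Qed.

Lemma strictly_lower_reflect x : strictly_lower x -> strictly_lower (reflect_mx x).
Proof. by move=> lx i j ij; rewrite mxE lx ?rmorph0 // leqNgt rev_ord_ltn -leqNgt. Qed.

(** Reflection intertwines the contraction operators of [t] and its image, fixes the Casimir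
    element, and respects triangularity. *)
Lemma BD_like_reflect t : BD_like t -> BD_like (reflect_tens t).
Proof.
move=> [ot tC [m fm]]; split.
- by move=> i j k l; rewrite tcoord_reflect fmorph_eq0 => /ot;
  rewrite !rev_ord_ltn => -[-> ->].
- apply: tcoordP => i j k l;
  move/(congr1 (fun u => bar (tcoord u (rev_ord j) (rev_ord i) (rev_ord l) (rev_ord k)))):
    tC.
  rewrite /= !tcoord_casimir !tcoordD !tcoord_flip rmorphD !tcoord_reflect => ->.
  rewrite rmorphB rmorphM fmorphV !rmorph_nat !(inj_eq rev_ord_inj).
  by rewrite andbC [l == i]eq_sym [j == k]eq_sym [j == i]eq_sym [l == k]eq_sym.
- exists m => x lx; suff -> : iter m (contract (reflect_tens t)) x =
      reflect_mx (iter m (contract t) (reflect_mx x)).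
    by rewrite fm ?reflect_mx0 //; apply: strictly_lower_reflect.
  by elim: m {fm} => [|m /= ->]; rewrite ?reflect_mxK // contract_reflect.
Qed.

End Reflection.

(** * Recovering the triple from coordinates at simple roots *)

Section SimpleCoefficients.

Variables (K : fieldType) (n : nat) (T : BD_triple n).
Variable theta : 'M[K]_n -> 'M[K]_n.
Hypotheses (admT : admissible K T) (thetaT : is_theta T theta).
Variable r0 : 'M[K]_(n * n).
Hypothesis r0_cartan : tens_sub (@cartan K n) r0.
Hypothesis charK0 : [pchar K] =i pred0.

Local Notation G1 := (BD_G1 T).
Local Notation G2 := (BD_G2 T).
Local Notation tau := (BD_tau T).
Local Notation E i j := (delta_mx i j : 'M[K]_n).
Local Notation root := (root_vec K).
Local Notation alpha := (@simple_root K n).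
Local Notation r := (r0 + BD_r1 T theta).

(** Encodes that the [k]-th power of [tau] is defined at the simple root of index [i]. *)
Definition tau_orbit (k : nat) (i : 'I_n.-1) := forall l, (l < k)%N -> iter l tau i \in G1.

(** The partial order generated by [tau] on the simple roots; [k = 0] makes it reflexive. *)
Definition linked (i j : 'I_n.-1) := exists2 k, tau_orbit k i & iter k tau i = j.

Lemma iter_tau_ext_simple k i :
  tau_orbit k i -> iter k (tau_ext T) (alpha i) = alpha (iter k tau i).
Proof.
elim: k => // k IHk ki; rewrite !iterS IHk => [|l lk]; last by apply: ki; apply: ltnW.
by rewrite tau_ext_simple // ki.
Qed.

Lemma simple_root_spanE i : (alpha i \in span_G1 K T) = (i \in G1).
Proof.
apply/idP/idP => [|/(simple_root_span K) //].
by move/(mem_root_span (ord_lo_hi i)); apply; rewrite /= leqnn ltnS leqnn.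
Qed.

Lemma tau_defined_simpleP k i : reflect (tau_orbit k i) (tau_defined T k (alpha i)).
Proof.
apply: (iffP idP).
  elim: k => [_ []//|k IHk]; rewrite tau_definedS => /andP[/IHk ki].
  rewrite iter_tau_ext_simple // simple_root_spanE => kG l.
  by rewrite ltnS leq_eqVlt => /orP[/eqP->|/ki].
elim: k => [_|k IHk ki]; first by apply/forallP => -[].
have ki' : tau_orbit k i by move=> l lk; apply: ki; apply: ltnW.
by rewrite tau_definedS IHk // iter_tau_ext_simple // simple_root_spanE ki.
Qed.

Lemma iter_theta_simple k i :
  tau_orbit k i -> iter k theta (e_neg K i) = e_neg K (iter k tau i).
Proof.
have [thetaE _ _ _ _] := thetaT.
elim: k => // k IHk ki; rewrite !iterS IHk => [|l lk]; last by apply: ki; apply: ltnW.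
by have [_ ->] := thetaE _ (ki k (leqnn _)).
Qed.

Lemma e_neg_coef (i j : 'I_n.-1) : e_neg K i (ord_hi j) (ord_lo j) = (i == j)%:R.
Proof.
by rewrite mxE (inj_eq (@ord_hi_inj n)) (inj_eq (@ord_lo_inj n)) andbb eq_sym.
Qed.

(** The Cartan part is diagonal, and the subtracted half of a wedge has a lower first factor, so
    neither contributes. On simple roots [theta] introduces no signs; the coefficient is therefore a
    natural number, and in characteristic zero its terms cannot cancel. *)
Lemma simple_coefE i j : tcoord r (ord_lo i) (ord_hi i) (ord_hi j) (ord_lo j) =
  ((i == j) + \sum_(1 <= k < n | tau_defined T k (alpha i)) (iter k tau i == j))%N%:R.
Proof.
have lohi : ord_lo i != ord_hi i by rewrite -val_eqE /= ltn_eqF.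
have Epq (p q : 'I_n) : (p, q) != (ord_lo i, ord_hi i) -> E p q (ord_lo i) (ord_hi i) = 0.
  by rewrite mxE xpair_eqE [ord_lo i == p]eq_sym [ord_hi i == q]eq_sym => /negPf->.
rewrite tcoordD [X in X + _](_ : _ = 0) ?add0r; last first.
  by apply/eqP; apply: contraTT lohi => /(tcoord_cartan r0_cartan)[->]; rewrite eqxx.
rewrite tcoordD natrD; congr (_ + _).
  rewrite tcoord_sum (bigD1 (ord_lo i)) //= tcoord_sum (bigD1 (ord_hi i)) ?ord_lo_hi //=.
  rewrite tcoord_tens -/(e_neg K i) e_neg_coef mxE !eqxx mul1r !big1 ?addr0 //.
    move=> p pi; rewrite tcoord_sum big1 // => q _; rewrite tcoord_tens Epq ?mul0r //.
    by rewrite xpair_eqE (negPf pi).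
  move=> q /andP[_ qi]; rewrite tcoord_tens Epq ?mul0r //.
  by rewrite xpair_eqE (negPf qi) andbF.
have wedgeE (p q : 'I_n) k : (p < q)%N -> tau_defined T k (root p q) ->
    tcoord (tens_wedge (E p q) (iter k theta (E q p)))
      (ord_lo i) (ord_hi i) (ord_hi j) (ord_lo j) =
    E p q (ord_lo i) (ord_hi i) * iter k theta (E q p) (ord_hi j) (ord_lo j).
  move=> pq kd; rewrite /tens_wedge tcoordB !tcoord_tens.
  have [i' [j' [eps [ij' -> _]]]] := iter_theta_root_vector thetaT pq kd.
  suff -> : (eps *: E j' i') (ord_lo i) (ord_hi i) = 0 by rewrite mul0r subr0.
  rewrite !mxE; have [iE|_] := eqVneq (ord_lo i) j'; last by rewrite mulr0.
  have [jE|_] := eqVneq (ord_hi i) i'; last by rewrite mulr0.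
  by move: ij'; rewrite -iE -jE ltnNge (ltnW (ord_lo_hi i)).
rewrite tcoord_sum (bigD1 (ord_lo i)) //= [X in _ + X]big1 ?addr0; last first.
  move=> p pi; rewrite tcoord_sum big1 // => q /andP[pq _].
  rewrite tcoord_sum big1 // => k kd; rewrite wedgeE // Epq ?mul0r //.
  by rewrite xpair_eqE (negPf pi).
rewrite natr_sum tcoord_sum.
have [iG|iG] := boolP (i \in G1); last first.
  rewrite big1 => [|q /andP[iq qG]]; last first.
    rewrite tcoord_sum big1 // => k kd; rewrite wedgeE //.
    have [qi|qi] := eqVneq q (ord_hi i); last first.
      by rewrite Epq ?mul0r // xpair_eqE (negPf qi) andbF.
    by rewrite qi -/(alpha i) simple_root_spanE (negPf iG) in qG.
  rewrite big_seq_cond big1 // => k; rewrite mem_index_iota.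
  case/andP => /andP[k0 _] /tau_defined_simpleP /(_ 0%N k0) /=.
  by rewrite (negPf iG).
rewrite (bigD1 (ord_hi i)) /=; last by rewrite -/(alpha i) simple_root_spanE iG ltnS leqnn.
rewrite [X in _ + X]big1 ?addr0; last first.
  move=> q /andP[/andP[iq _] qi]; rewrite tcoord_sum big1 // => k kd.
  by rewrite wedgeE // Epq ?mul0r // xpair_eqE (negPf qi) andbF.
rewrite tcoord_sum; apply: eq_bigr => k kd; rewrite wedgeE ?ord_lo_hi //.
rewrite -/(e_neg K i) iter_theta_simple ?e_neg_coef; last exact/tau_defined_simpleP.
by rewrite mxE !eqxx mul1r.
Qed.

Lemma simple_coefP i j :
  tcoord r (ord_lo i) (ord_hi i) (ord_hi j) (ord_lo j) != 0 <-> linked i j.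
Proof.
rewrite simple_coefE ((pcharf0P _).1 charK0) addn_eq0 negb_and.
split=> [/orP[|H]|[k ki kj]].
- by rewrite eqb0 negbK => /eqP->; exists 0%N.
- move: H; rewrite sum_nat_seq_neq0 => /hasP[k _ /andP[/tau_defined_simpleP ki]].
  by rewrite eqb0 negbK => /eqP kj; exists k.
- case: k ki kj => [_ /= ->|k ki kj]; first by rewrite eqxx.
  apply/orP; right; rewrite sum_nat_seq_neq0; apply/hasP; exists k.+1.
    rewrite mem_index_iota /=; apply: (@tau_defined_ltn K n T _ _ _ admT (ord_lo_hi i)).
    exact/tau_defined_simpleP.
  by rewrite kj eqxx andbT; apply/tau_defined_simpleP.
Qed.

(** On a cycle, reducing the exponent modulo [k] shows that every iterate stays in [G1], which
    admissibility excludes. *)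
Lemma tau_no_cycle k i : (0 < k)%N -> tau_orbit k i -> iter k tau i <> i.
Proof.
move=> k0 ki kE; have [_ _ _ nilp] := admT.
have [m] := nilp i (ki 0%N k0); case/negP.
rewrite (divn_eq m k) addnC iterD.
suff -> : iter (m %/ k * k) tau i = i by apply: ki; rewrite ltn_mod.
by elim: (m %/ k)%N => // q IHq; rewrite mulSn iterD IHq.
Qed.

(** Opposite links between distinct roots would concatenate to a cycle of [tau]. *)
Lemma linked_antisym i j : linked i j -> linked j i -> i = j.
Proof.
move=> [[|p] pi pj] // [q qj qi].
exfalso; apply: (@tau_no_cycle (q + p.+1) i); first by rewrite addnS.
  move=> l lqp; have [/pi //|pl] := ltnP l p.+1.
  by rewrite -(subnK pl) iterD pj; apply: qj; rewrite ltn_subLR // addnC.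
by rewrite iterD pj.
Qed.

Lemma linked_tau i : i \in G1 -> linked i (tau i).
Proof. by move=> iG; exists 1%N => // -[]. Qed.

Lemma linked_neq i j : linked i j -> i != j -> i \in G1 /\ linked (tau i) j.
Proof.
move=> [[|k] ki <-]; first by rewrite eqxx.
move=> _; split; first exact: (ki 0%N).
exists k; last by rewrite -iterSr.
by move=> l lk; rewrite -iterSr; apply: ki.
Qed.

Lemma tau_neq i : i \in G1 -> i != tau i.
Proof.
move=> iG; apply/eqP => iE; apply: (@tau_no_cycle 1 i) => //.
by move=> -[].
Qed.

Lemma mem_G1P i : reflect (exists2 j, linked i j & i != j) (i \in G1).
Proof.
apply: (iffP idP) => [iG|[j ij /(linked_neq ij)[]] //].
by exists (tau i); [exact: linked_tau|exact: tau_neq].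
Qed.

Lemma mem_G2P j : reflect (exists2 i, linked i j & i != j) (j \in G2).
Proof.
have [<- _ _ _] := admT; apply: (iffP imsetP) => [[i iG ->]|[i [[|k] ki kj]]].
- by exists i; [exact: linked_tau|exact: tau_neq].
- by rewrite -kj eqxx.
- by move=> _; exists (iter k tau i); [exact: ki|rewrite -iterS kj].
Qed.

(** The order determines the triple: [G1] consists of the roots with a proper successor, [G2] of
    those with a proper predecessor, and [tau i] is the first proper successor of [i]. A symmetry of
    the order is thus a symmetry of the triple. *)
Lemma linked_sym_triple :
    (forall i j, linked i j <-> linked (rev_ord i) (rev_ord j)) ->
  [/\ @rev_ord n.-1 @: G1 = G1, @rev_ord n.-1 @: G2 = G2
    & {in G1, forall i, rev_ord (tau i) = tau (rev_ord i)}].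
Proof.
move=> sym.
have imE (A : {set 'I_n.-1}) : (forall i, i \in A -> rev_ord i \in A) -> @rev_ord n.-1 @:
  A = A.
  move=> AA; apply/setP => i; apply/imsetP/idP => [[j jA ->]|iA]; first exact: AA.
  by exists (rev_ord i); rewrite ?AA ?rev_ordK.
have G1r i : i \in G1 -> rev_ord i \in G1.
  move=> /mem_G1P[j ij nij]; apply/mem_G1P; exists (rev_ord j); first exact: (sym _ _).1.
  by rewrite (inj_eq rev_ord_inj).
split; [exact: imE| |].
  apply: imE => j /mem_G2P[i ij nij]; apply/mem_G2P; exists (rev_ord i);
    first exact: (sym _ _).1.
  by rewrite (inj_eq rev_ord_inj).
(* Using this for [rev_ord i] and reflecting gives the opposite link; antisymmetry then yields
   equality. *)
have half i : i \in G1 -> linked (tau (rev_ord i)) (rev_ord (tau i)).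
  move=> iG; apply: proj2 (linked_neq _ _); first exact: (sym _ _).1 (linked_tau iG).
  by rewrite (inj_eq rev_ord_inj); apply: tau_neq.
move=> i iG; apply: linked_antisym; last exact: half.
have := (sym _ _).1 (half _ (G1r _ iG)).
by rewrite !rev_ordK.
Qed.

End SimpleCoefficients.

(** * A symmetric triple makes [r1] invariant under reflection *)

Section SymmetricTriple.

Variables (K : fieldType) (bar : {rmorphism K -> K}) (n : nat) (T : BD_triple n).
Variable theta : 'M[K]_n -> 'M[K]_n.
Hypothesis thetaT : is_theta T theta.

Local Notation G1 := (BD_G1 T).
Local Notation tau := (BD_tau T).
Local Notation E i j := (delta_mx i j : 'M[K]_n).
Local Notation root := (root_vec K).
Local Notation alpha := (@simple_root K n).
Local Notation B := (simple_roots K n).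
Local Notation span1 := (span_G1 K T).

Hypothesis G1_sym : @rev_ord n.-1 @: G1 = G1.
Hypothesis tau_sym : {in G1, forall i, rev_ord (tau i) = tau (rev_ord i)}.

Lemma mem_rev_G1 i : i \in G1 -> rev_ord i \in G1.
Proof. by move=> iG; rewrite -G1_sym imset_f. Qed.

(** The two reversals act on [n] positions and on [n - 1] simple roots; the shift by one between
    them exchanges the two ends of a simple root. *)
Lemma rev_ord_lo (i : 'I_n.-1) : rev_ord (ord_lo i) = ord_hi (rev_ord i).
Proof. by apply: val_inj;
  rewrite /= -subSn // prednK // (leq_ltn_trans _ (ltn_ord (ord_lo i))). Qed.

Lemma rev_ord_hi (i : 'I_n.-1) : rev_ord (ord_hi i) = ord_lo (rev_ord i).
Proof. by rewrite -[RHS]rev_ordK rev_ord_lo rev_ordK. Qed.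

(* The linear automorphism of the root space induced by [alpha_i |-> alpha_(n-i)]. *)
Definition root_reflect (v : 'rV[K]_n) : 'rV[K]_n := - \row_j v 0 (rev_ord j).

Lemma root_reflect_root i j : root_reflect (root i j) = root (rev_ord j) (rev_ord i).
Proof.
apply/rowP => k; rewrite !mxE !eqxx /= opprB.
by rewrite -(inj_eq rev_ord_inj) rev_ordK -[rev_ord k == i](inj_eq rev_ord_inj) rev_ordK.
Qed.

Lemma root_reflect_simple m : root_reflect (alpha m) = alpha (rev_ord m).
Proof. by rewrite root_reflect_root rev_ord_lo rev_ord_hi. Qed.

Lemma root_reflect_comb (c : 'I_n.-1 -> K) (w : 'I_n.-1 -> 'rV[K]_n) :
  root_reflect (\sum_(m in G1) c m *: w m) = \sum_(m in G1) c m *: root_reflect (w m).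
Proof.
apply/rowP => k; rewrite !mxE !summxE -sumrN; apply: eq_bigr => m _.
by rewrite !mxE mulrN.
Qed.

Lemma span_G1_expand v : v \in span1 -> v = \sum_(m in G1) coord B m v *: alpha m.
Proof.
move=> vG; have vB : v \in <<B>>%VS.
  move: vG; apply/subvP/span_subvP => _ /imageP[l _ ->].
  by rewrite -simple_roots_nth; apply/memv_span/mem_nth; rewrite size_tuple.
rewrite {1}(coord_span vB) (bigID (mem G1)) /= [X in _ + X]big1 ?addr0.
  by apply: eq_bigr => m _; rewrite simple_roots_nth.
move=> m mG; have [->|/(coord_span_G1 vG)] := eqVneq (coord B m v) 0.
  by rewrite scale0r.
by rewrite (negPf mG).
Qed.

Lemma tau_ext_comb (c : 'I_n.-1 -> K) (w : 'I_n.-1 -> 'rV[K]_n) :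
  tau_ext T (\sum_(m in G1) c m *: w m) = \sum_(m in G1) c m *: tau_ext T (w m).
Proof.
rewrite /tau_ext; under [RHS]eq_bigr => m _ do rewrite scaler_sumr.
rewrite exchange_big; apply: eq_bigr => p _ /=; rewrite linear_sum scaler_suml.
by apply: eq_bigr => m _; rewrite linearZ scalerA.
Qed.

Lemma root_reflect_span v : v \in span1 -> root_reflect v \in span1.
Proof.
move=> /span_G1_expand->; rewrite root_reflect_comb memv_suml // => m mG.
by rewrite memvZ // root_reflect_simple simple_root_span // mem_rev_G1.
Qed.

Lemma tau_ext_reflect v :
  v \in span1 -> tau_ext T (root_reflect v) = root_reflect (tau_ext T v).
Proof.
move=> /span_G1_expand->; rewrite root_reflect_comb !tau_ext_comb root_reflect_comb.
apply: eq_bigr => m mG; congr (_ *: _).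
by rewrite root_reflect_simple !tau_ext_simple ?mem_rev_G1 // root_reflect_simple tau_sym.
Qed.

Lemma tau_defined_reflect k v : tau_defined T k v ->
  tau_defined T k (root_reflect v)
  /\ iter k (tau_ext T) (root_reflect v) = root_reflect (iter k (tau_ext T) v).
Proof.
elim: k => [_|k IHk]; first by split=> //; apply/forallP => -[].
rewrite !tau_definedS => /andP[/IHk[kd kE] kG]; rewrite kd /= kE.
by rewrite root_reflect_span // tau_ext_reflect.
Qed.

Lemma root_reflectK v : root_reflect (root_reflect v) = v.
Proof. by apply/rowP => k; rewrite !mxE opprK rev_ordK. Qed.

Lemma tau_defined_reflectE k v : tau_defined T k (root_reflect v) = tau_defined T k v.
Proof.
by apply/idP/idP => /tau_defined_reflect[]; rewrite ?root_reflectK.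
Qed.

Lemma root_reflect_spanE v : (root_reflect v \in span1) = (v \in span1).
Proof.
by apply/idP/idP => /root_reflect_span; rewrite ?root_reflectK.
Qed.

Lemma lie_genZ (c : K) a : lie_gen G1 a -> lie_gen G1 (c *: a).
Proof. by move=> aG; rewrite -[_ *: _]addr0; apply: LieGenLin => //; apply: LieGen0. Qed.

(** Induction on the generation of the subalgebra: on generators this is the symmetry of [tau], and
    reflection reverses brackets in the same way before and after [theta]. *)
Lemma theta_reflect a : lie_gen G1 a ->
  lie_gen G1 (reflect_mx bar a) /\ reflect_mx bar (theta a) = theta (reflect_mx bar a).
Proof.
have [thetaE thetaL thetaBr _ _] := thetaT.
elim=> {a} [i iG|i iG||c a b aG [aG' IHa] bG [bG' IHb]|a b aG [aG' IHa] bG [bG' IHb]].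
- have eE (j : 'I_n.-1) : reflect_mx bar (e_pos K j) = e_pos K (rev_ord j).
    by rewrite reflect_mx_delta rev_ord_lo rev_ord_hi.
  have iG' := mem_rev_G1 iG; rewrite eE; split; first exact: LieGenPos.
  by rewrite (thetaE _ iG).1 (thetaE _ iG').1 eE tau_sym.
- have eE (j : 'I_n.-1) : reflect_mx bar (e_neg K j) = e_neg K (rev_ord j).
    by rewrite reflect_mx_delta rev_ord_lo rev_ord_hi.
  have iG' := mem_rev_G1 iG; rewrite eE; split; first exact: LieGenNeg.
  by rewrite (thetaE _ iG).2 (thetaE _ iG').2 eE tau_sym.
- by rewrite (theta0 thetaT) reflect_mx0 (theta0 thetaT); split=> //; apply: LieGen0.
- rewrite thetaL // !reflect_mxD !reflect_mxZ IHa IHb thetaL //; split=> //.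
  exact: LieGenLin.
- rewrite thetaBr // !reflect_mx_br IHa IHb thetaBr //; split=> //.
  exact: LieGenBr.
Qed.

Lemma iter_theta_reflect k (i j : 'I_n) : (i < j)%N -> tau_defined T k (root i j) ->
  reflect_mx bar (iter k theta (E j i)) = iter k theta (E (rev_ord i) (rev_ord j)).
Proof.
move=> ij; elim: k => [_|k IHk]; first exact: reflect_mx_delta.
rewrite tau_definedS => /andP[kd kG]; rewrite !iterS -IHk //.
apply: proj2 (theta_reflect _).
(* The iterate is a multiple of a root vector whose root lies in the span of [G1], hence it belongs
   to the subalgebra on which [theta] is controlled. *)
have [i' [j' [eps [ij' -> R']]]] := iter_theta_root_vector thetaT ij kd.
rewrite -R' in kG; apply: lie_genZ.
by have [] := theta_root_vector thetaT ij' kG.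
Qed.

Lemma reflect_r1 : reflect_tens bar (BD_r1 T theta) = BD_r1 T theta.
Proof.
(* This is the permutation of positive roots induced by reflection; reindexing by it matches the
   sums term by term. *)
have rev2_inj : injective (fun p : 'I_n * 'I_n => (rev_ord p.2, rev_ord p.1)).
  by move=> [i j] [k l] /= /eqP;
    rewrite xpair_eqE !(inj_eq rev_ord_inj) => /andP[/eqP-> /eqP->].
rewrite /BD_r1 reflect_tensD; congr (_ + _).
  rewrite pair_big_dep /= [LHS]reflect_tens_sum [RHS](reindex_inj rev2_inj) /=.
  apply: eq_big => [[i j]|[i j] _] /=; first by rewrite rev_ord_ltn.
  by rewrite reflect_tens_tens !reflect_mx_delta.
rewrite pair_big_dep /= [LHS]reflect_tens_sum [RHS](reindex_inj rev2_inj) /=.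
apply: eq_big => [[i j]|[i j] /andP[/= ij rG]] /=.
  by rewrite rev_ord_ltn -root_reflect_root root_reflect_spanE.
rewrite reflect_tens_sum; apply: eq_big => [k|k kd].
  by rewrite -root_reflect_root tau_defined_reflectE.
by rewrite /tens_wedge reflect_tensB !reflect_tens_tens reflect_mx_delta iter_theta_reflect.
Qed.

End SymmetricTriple.

(** * The criterion in terms of [S X^* X], and its assembly *)

Section Criterion.

Variables (K : fieldType) (bar : {rmorphism K -> K}) (n : nat).
Implicit Types (X N : 'M[K]_n) (t : 'M[K]_(n * n)).
Local Notation S := (antidiag_mx K n).

Lemma conjtr_Ad2 X t :
  conjtr bar (Ad2 X t) = Ad2 (invmx (conjtr bar X)) (conjtr bar t).
Proof. by rewrite !Ad2E invmxK !conjtrM !conjtr_tens conjtr_inv mulmxA. Qed.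

(** The conjugate transpose turns conjugation by [X] into conjugation by the inverse of [X^*];
    moving this across and applying [Ad2 S] gives the right-hand form. *)
Lemma conjtr_Ad2_fixed X t : X \in unitmx ->
  conjtr bar (Ad2 X t) = Ad2 X t <-> Ad2 (S *m (conjtr bar X *m X)) t = reflect_tens bar t.
Proof.
move=> Xu; have sXu : conjtr bar X \in unitmx by rewrite conjtr_unit.
have Su := antidiag_unit K n.
rewrite conjtr_Ad2 /reflect_tens -Ad2M ?unitmx_mul ?sXu // -Ad2M //; split=> [<-|H].
  by rewrite Ad2Kinv.
have /(congr1 (Ad2 (invmx S))) := H; rewrite !Ad2K // => <-.
by rewrite Ad2K.
Qed.

Lemma map_mx_Ad2 (L : fieldType) (iota : {rmorphism K -> L}) X t :
  map_mx iota (Ad2 X t) = Ad2 (map_mx iota X) (map_mx iota t).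
Proof. by rewrite !Ad2E !map_mxM !map_mxT map_invmx. Qed.

Lemma map_mx_antidiag (L : fieldType) (iota : {rmorphism K -> L}) :
  map_mx iota S = antidiag_mx L n.
Proof. by apply/matrixP => i j; rewrite !mxE rmorph_nat. Qed.

(** Transposition is trivial on tensors of diagonal matrices, and [S] is its own inverse. *)
Lemma reflect_cartan t : tens_sub (@cartan K n) t ->
  reflect_tens bar t = t <-> map_mx bar t = Ad2 S t.
Proof.
move=> tc; have bt : map_mx bar t = conjtr bar t.
  apply: tcoordP => i j k l; rewrite tcoord_conjtr [LHS]mxE -/(tcoord t i j k l).
  congr (bar _); have [t0|/(tcoord_cartan tc)[-> ->] //] := eqVneq (tcoord t i j k l) 0.
  have [t0'|/(tcoord_cartan tc)[ji lk]] := eqVneq (tcoord t j i l k) 0;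
    first by rewrite t0 t0'.
  by rewrite ji lk.
rewrite /reflect_tens bt; split=> E;
  last by rewrite E Ad2M ?antidiag_unit // antidiagK Ad2_1.
by rewrite -{2}E Ad2M ?antidiag_unit // antidiagK Ad2_1.
Qed.

End Criterion.

(** Diagonal conjugation does not change which coordinates vanish, and reflection carries the simple
    coordinate of [(i, j)] to that of the reversed pair. *)
Lemma linked_Ad2_diag (K : fieldType) (bar : {rmorphism K -> K}) (n : nat)
    (T : BD_triple n) (theta : 'M[K]_n -> 'M[K]_n) (r0 : 'M[K]_(n * n)) (N : 'M[K]_n) :
    [pchar K] =i pred0 -> admissible K T -> is_theta T theta -> tens_sub (@cartan K n) r0 ->
    N \in unitmx -> (forall i j, i != j -> N i j = 0) ->
    Ad2 N (r0 + BD_r1 T theta) = reflect_tens bar (r0 + BD_r1 T theta) ->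
  forall i j, linked T i j <-> linked T (rev_ord i) (rev_ord j).
Proof.
move=> charK0 admT thetaT r0c Nu Nd NE i j.
have coefP := simple_coefP admT thetaT r0c charK0.
have Nn0 k := diag_unitmx_neq0 k Nu Nd.
apply: (iff_trans (iff_sym (coefP i j)));
  apply: (iff_trans _ (coefP (rev_ord i) (rev_ord j))).
have := tcoord_Ad2_diag (ord_lo i) (ord_hi i) (ord_hi j) (ord_lo j) Nu Nd NE.
rewrite tcoord_reflect !rev_ord_lo !rev_ord_hi => E.
set c := tcoord _ _ _ _ _ in E *; set c' := tcoord _ _ _ _ _ in E *.
suff -> : (c == 0) = (c' == 0) by [].
have := congr1 (fun x => x == 0) E.
by rewrite !mulf_eq0 fmorph_eq0 !(negPf (Nn0 _)) /= orbF.
Qed.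

Lemma tcoord_r1_diag (K : fieldType) (n : nat) (T : BD_triple n)
    (theta : 'M[K]_n -> 'M[K]_n) (i k : 'I_n) :
  tcoord (BD_r1 T theta) i i k k = 0.
Proof.
have E0 (p q s : 'I_n) : (p < q)%N -> (delta_mx p q : 'M[K]_n) s s = 0.
  by move=> pq; rewrite mxE; case: eqP => //= ->; rewrite -val_eqE ltn_eqF.
rewrite /BD_r1 tcoordD !tcoord_sum !big1 ?addr0 // => p _; rewrite tcoord_sum big1 // => q.
  by case/andP=> pq _; rewrite tcoord_sum big1 // => m _;
    rewrite /tens_wedge tcoordB !tcoord_tens !E0 // mul0r mulr0 subrr.
by move=> pq; rewrite tcoord_tens E0 // mul0r.
Qed.

(** The quadratic extension enters only through the involution [bar] and an element that it
    negates. *)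
Lemma su_bialgebra_iff (K : fieldType) (bar : {rmorphism K -> K}) (barK : involutive bar)
    (dl : K) (bar_dl : bar dl = - dl) (dl_n0 : dl != 0) (charK0 : [pchar K] =i pred0)
    (L : fieldType) (iota : {rmorphism K -> L})
    (n : nat) (n_gt0 : (0 < n)%N)
    (T : BD_triple n) (r0 r1 : 'M[K]_(n * n)) (r_BD : is_BD_rmatrix T r0 r1)
    (X : 'M[K]_n) (X_GL : X \in unitmx) :
  defines_Lie_bialgebra (su bar (n := n)) (Ad2 X (r0 + r1)) <->
  [/\ exists2 D : 'M[L]_n,
        BD_centralizer (map_mx iota (r0 + r1)) D
        & map_mx iota (conjtr bar X *m X) = antidiag_mx L n *m D,
      map_mx bar r0 = Ad2 (antidiag_mx K n) r0,
      @rev_ord n.-1 @: BD_G1 T = BD_G1 T,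
      @rev_ord n.-1 @: BD_G2 T = BD_G2 T
    & {in BD_G1 T, forall i, rev_ord (BD_tau T i) = BD_tau T (rev_ord i)}].
Proof.
have [admT r0c r0f _ [theta thetaT ->]] := r_BD.
set r := r0 + _; pose N := antidiag_mx K n *m (conjtr bar X *m X).
have natK := (pcharf0P _).1 charK0.
have Nu : N \in unitmx by rewrite !unitmx_mul antidiag_unit conjtr_unit X_GL.
have critP : defines_Lie_bialgebra (su bar (n := n)) (Ad2 X r)
    <-> Ad2 N r = reflect_tens bar r.
  apply: iff_trans (conjtr_Ad2_fixed bar r X_GL); apply: (su_bialgebraP barK bar_dl) => //.
  - by rewrite natK.
  - by rewrite natK -lt0n.
  - by apply: tens_sub_sl_Ad2 => //; apply: tens_sub_sl_r.
  - by rewrite Ad2_flip -Ad2D r_flip // Ad2_casimir.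
have iotaN : map_mx iota N = antidiag_mx L n *m map_mx iota (conjtr bar X *m X).
  by rewrite [LHS]map_mxM map_mx_antidiag.
apply: (iff_trans critP); split=> [NE|[[D [Du Dr] XD] r0S G1s G2s taus]]; last first.
  (* Since [S] squares to the identity, [D] is forced to be the image of [N]; injectivity of [iota]
     then brings the centralizing relation down to [K]. *)
  have ND : map_mx iota N = D.
    by rewrite iotaN XD mulmxA antidiagK mul1mx.
  have -> : reflect_tens bar r = r.
    by rewrite reflect_tensD (reflect_r1 _ thetaT G1s taus) ((reflect_cartan bar r0c).2
      r0S).
  by apply: (map_mx_inj (f := iota)); rewrite map_mx_Ad2 ND.
have rBD : BD_like r by apply: BD_like_r.
have Nd := Ad2_BD_like_diag Nu rBD (BD_like_reflect barK rBD) NE.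
have [G1s G2s taus] := linked_sym_triple admT (linked_Ad2_diag charK0 admT thetaT r0c Nu
  Nd NE).
(* Outside [h (x) h] both sides vanish. On [E_jj (x) E_ll] the factors from [N] cancel and [r1] has
   no coordinate. *)
have r0S : reflect_tens bar r0 = r0.
  apply: tcoordP => i j k l; rewrite tcoord_reflect.
  have off t0 : tens_sub (@cartan K n) t0 -> ~~ ((i == j) && (k == l)) -> tcoord t0 i j k
    l = 0.
    by move=> t0c; apply: contraNeq => /(tcoord_cartan t0c)[-> ->]; rewrite !eqxx.
  have [/andP[/eqP-> /eqP->]|ijkl] := boolP ((i == j) && (k == l)); last first.
    rewrite (off r0) //; have [->|] := eqVneq (tcoord r0 (rev_ord j) (rev_ord i) (rev_ord
      l) (rev_ord k)) 0.
      by rewrite rmorph0.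
    move=> /(tcoord_cartan r0c)[/rev_ord_inj ji /rev_ord_inj lk].
    by rewrite ji lk !eqxx in ijkl.
  have := tcoord_Ad2_diag j j l l Nu Nd NE.
  rewrite mulrC => /mulIf;
    rewrite tcoord_reflect /r !(tcoordD r0) !tcoord_r1_diag !addr0 => -> //.
  by rewrite mulf_neq0 // diag_unitmx_neq0.
split=> //; last exact/(reflect_cartan bar r0c).
exists (map_mx iota N); last by rewrite iotaN mulmxA antidiagK mul1mx.
split; first by rewrite map_unitmx.
rewrite -map_mx_Ad2 NE reflect_tensD r0S; congr (map_mx _ (_ + _)).
exact: reflect_r1 thetaT G1s taus.
Qed.

Theorem proposition6p5
    (F : fieldType) (charF0 : [pchar F] =i pred0)
    (d : F) (d_neq0 : d != 0) (d_nonsquare : forall c : F, c != 0 -> c ^+ 2 != d)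
    (K : splittingFieldType F) (delta : K) (delta_sq : delta ^+ 2 = d%:A)
    (K_gen : <<1; delta>>%VS = {:K}%VS)
    (bar : gal_of {:K}) (bar_gal : bar \in 'Gal({:K} / 1)%g)
    (bar_nontrivial : bar != 1%g)
    (Fbar : closedFieldType) (iota : {rmorphism K -> Fbar})
    (Fbar_algebraic : forall z : Fbar,
       algebraicOver (fun x : F => iota (in_alg K x)) z)
    (n : nat) (n_gt0 : (0 < n)%N)
    (T : BD_triple n) (r0 r1 : 'M[K]_(n * n)) (r_BD : is_BD_rmatrix T r0 r1)
    (X : 'M[K]_n) (X_GL : X \in unitmx) :
  defines_Lie_bialgebra (su bar (n := n)) (Ad2 X (r0 + r1)) <->
  [/\ exists2 D : 'M[Fbar]_n,
        BD_centralizer (map_mx iota (r0 + r1)) D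
        & map_mx iota (conjtr bar X *m X) = antidiag_mx Fbar n *m D,
      map_mx bar r0 = Ad2 (antidiag_mx K n) r0,
      @rev_ord n.-1 @: BD_G1 T = BD_G1 T,
      @rev_ord n.-1 @: BD_G2 T = BD_G2 T
    & {in BD_G1 T, forall i, rev_ord (BD_tau T i) = BD_tau T (rev_ord i)}].
Proof.
(* An automorphism is determined by its value on the generator [delta]. *)
have gal_fix (g : gal_of {:K}) : g \in 'Gal({:K} / 1)%g -> g delta = delta -> g = 1%g.
  rewrite -K_gen in g * => gG gd; apply/eqP.
  by rewrite (gal_adjoin_eq gG (group1 _)) gal_id gd.
have charK0 : [pchar K] =i pred0 by move=> p; rewrite pchar_lalg charF0.
have two_n0 : 2%:R != 0 :> K by rewrite ((pcharf0P _).1 charK0).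
have delta_n0 : delta != 0.
  by rewrite -sqrf_eq0 delta_sq scaler_eq0 negb_or d_neq0 oner_eq0.
(* The image of [delta] is again a square root of [d], and it is not [delta] itself because [bar] is
   nontrivial. *)
have bar_delta : bar delta = - delta.
  have : (bar delta) ^+ 2 == delta ^+ 2 by rewrite -rmorphXn /= delta_sq linearZ /= rmorph1.
  rewrite eqf_sqr => /orP[/eqP bd|/eqP //].
  by rewrite (gal_fix bar) ?eqxx // in bar_nontrivial.
(* The square of [bar] fixes [delta], so it is the identity. *)
have barK : involutive bar.
  move=> x; rewrite -galM ?memvf // (gal_fix (bar * bar)%g) ?gal_id ?groupM //.
  by rewrite galM ?memvf // bar_delta rmorphN /= bar_delta opprK.
exact: (su_bialgebra_iff barK bar_delta delta_n0 charK0).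
Qed.
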